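(* Let $g:\mathbb{Z}\to[0,\infty)$ be such that $\liminf_{k\to\infty}g(q_0k)^{1/k}\geq1$ for every $q_0\in\mathbb{N}$. Let $\xi\in\mathbb{R}$ satisfy $|\xi-p/q|\geq g(q)\geq0$ for all $p\in\mathbb{Z}$, $q\in\mathbb{N}$, let $\beta=e^{2i\pi\xi}$, $\varphi(z)=\beta z$, and $C_\varphi f=f\circ\varphi$ on $\mathrm{Hol}(\mathbb{D})$. Then $$\{\beta^n:n\in\mathbb{N}_0\}\subset\sigma(C_\varphi)\subset\{e^{2i\pi x}:x\in\mathbb{R}\setminus\mathbb{Q}\}\cup\{1\}.$$
   Context: $\mathbb{D}$ is the open unit disc, $\mathrm{Hol}(\mathbb{D})$ the Fréchet space of holomorphic functions on $\mathbb{D}$, $\mathbb{N}_0=\mathbb{N}\cup\{0\}$. $\sigma(C_\varphi)$ is the set of $\lambda\in\mathbb{C}$ such that $\lambda\mathrm{Id}-C_\varphi$ is not bijective on $\mathrm{Hol}(\mathbb{D})$. *)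

(* Defs.v *)
From Stdlib Require Import Reals ZArith.
From Coquelicot Require Import Coquelicot.
Open Scope R_scope.

Definition in_disc (z : C) : Prop := Cmod z < 1.

(* f (a function C -> C) is holomorphic on D: complex differentiable at every point of D.
   Elements of Hol(D) are such functions, identified when they agree on D. *)
Definition Hol (f : C -> C) : Prop := forall z : C, in_disc z -> ex_derive f z.

Definition e2ipi (x : R) : C := (cos (2 * PI * x), sin (2 * PI * x)).

Definition Comp (beta : C) (f : C -> C) : C -> C := fun z => f (Cmult beta z).

Definition bijective_on_Hol (beta lam : C) : Prop :=
  (forall f1 f2 : C -> C, Hol f1 -> Hol f2 ->
     (forall z, in_disc z ->
        Cminus (Cmult lam (f1 z)) (Comp beta f1 z) =
        Cminus (Cmult lam (f2 z)) (Comp beta f2 z)) ->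
     forall z, in_disc z -> f1 z = f2 z) /\
  (forall h : C -> C, Hol h ->
     exists f : C -> C, Hol f /\
       forall z, in_disc z -> Cminus (Cmult lam (f z)) (Comp beta f z) = h z).

Definition spectrum (beta : C) : C -> Prop := fun lam => ~ bijective_on_Hol beta lam.

Definition rational (x : R) : Prop :=
  exists (p : Z) (q : Z), q <> 0%Z /\ x = IZR p / IZR q.

Definition nth_root (x : R) (k : nat) : R :=
  if Req_EM_T x 0 then 0 else Rpower x (/ INR k).

(* Main.v *)
(* A function that is complex differentiable on the disc is the sum of its Taylor series; no
   continuity of the derivative is assumed.  Goursat's bisection, applied to [F = G o exp] on
   rectangles of width [2 pi] in the imaginary direction, shows that the integral of [G] over the
   circle of radius [r] does not depend on [r], even when [G] is only continuous on one exceptional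
   circle.  With [G z = z (f z - f z0) / (z - z0)] the integral vanishes in the limit [r -> 0], and
   expanding [z / (z - z0)] geometrically gives the Taylor series of [f] at [z0].

   On Taylor coefficients, [lam - C_phi] is the multiplication by [lam - beta^n].  It is injective
   as soon as no [beta^n] equals [lam], and it is onto if moreover [|lam - beta^n| >= rho^n] for
   every [rho < 1] and all large [n].  This is clear if [|lam| <> 1]; if [lam = e^(2 i pi p / q)],
   then [|lam - beta^n|] is at least [n |xi - p' / (q n)| >= g (q n)] for some integer [p']. *)

Require Import Defs.
From Stdlib Require Import Reals ZArith Lra Lia Classical ClassicalEpsilon.
From Coquelicot Require Import Coquelicot.
Open Scope R_scope.

(** * Complex differentiability *)

(** The quotient [(f z - f z0) / (z - z0)] extends continuously to [z0], but its differentiability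
    there would already need the expansion being proved. Goursat's theorem therefore cannot be
    applied across [z0], and the circle through [z0] has to be exceptional. Under [exp] this circle
    becomes a vertical line; the integral over vertical segments is constant on either side of the
    line and continuous across it. The horizontal sides of the rectangles cancel by periodicity. The
    factor [z] in [G] comes from [dz = i z dt]: all circle integrals are taken in the angle, so the
    integral of [G] is, up to [i], the contour integral of the quotient. It also makes [G] vanish at
    the origin, which gives the limit. In the Diophantine part the root of [g (q n)] is of order
    [n], not [q n]. This is the rate at which division by [lam - beta^n] keeps the radius of
    convergence at least 1, and it is why the hypothesis on [g] is needed along the multiples of
    every [q0]. The other inclusion is elementary: [z^n] is an eigenvector for [beta^n]. *)

Definition ccont (f : C -> C) (z : C) : Prop :=
  forall eps, 0 < eps -> exists del, 0 < del /\
    forall w, Cmod (w - z) < del -> Cmod (f w - f z) < eps.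

(* Caratheodory's form of differentiability: [q z] is the derivative of [f] at [z], and the rules
   for products, composites and inverses are identities between the functions [q]. *)
Definition cdiff (f : C -> C) (z : C) : Prop :=
  exists q : C -> C, ccont q z /\
    exists del, 0 < del /\
      forall w, Cmod (w - z) < del -> f w = (f z + q w * (w - z))%C.

Lemma Cmod_minus_rev (x y : C) : Cmod (x - y) = Cmod (y - x).
Proof. rewrite <- Cmod_opp. f_equal. ring. Qed.

Lemma Cmod_minus_triangle (x y : C) : Cmod x <= Cmod y + Cmod (x - y).
Proof. replace x with (y + (x - y))%C at 1 by ring. apply Cmod_triangle. Qed.

Lemma Cmod_minus_le (x y : C) : Cmod (x - y) <= Cmod x + Cmod y.
Proof. rewrite <- (Cmod_opp y). apply Cmod_triangle. Qed.

Lemma Cmod_self_minus (z : C) : Cmod (z - z) = 0.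
Proof. replace (z - z)%C with (RtoC 0) by ring. apply Cmod_0. Qed.

(** [is_derive] asks for the estimate at every limit of the filter [locally z], and [z] is the only
    one. *)
Lemma is_derive_C_iff (f : C -> C) (z l : C) :
  is_derive f z l <->
  forall eps, 0 < eps -> exists del, 0 < del /\
    forall w, Cmod (w - z) < del -> Cmod (f w - f z - (w - z) * l) <= eps * Cmod (w - z).
Proof.
split.
- intros [_ H] eps He.
  destruct (H z (fun P HP => HP) (mkposreal eps He)) as [d Hd].
  exists d; split; [apply cond_pos|].
  intros w Hw. exact (Hd w Hw).
- intros H. split.
  + apply is_linear_scal_l.
  + intros x Hx eps.
    assert (E : x = z).
    { symmetry. apply is_filter_lim_locally_unique. exact Hx. }
    subst x.
    destruct (H eps (cond_pos eps)) as [d [Hd H']].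
    exists (mkposreal d Hd). intros w Hw. exact (H' w Hw).
Qed.

Lemma ccont_const (c z : C) : ccont (fun _ => c) z.
Proof.
intros e He. exists 1; split; [lra|]. intros w _. rewrite Cmod_self_minus. exact He.
Qed.

Lemma ccont_id (z : C) : ccont (fun w => w) z.
Proof. intros e He. exists e; split; auto. Qed.

Lemma ccont_plus (f g : C -> C) (z : C) :
  ccont f z -> ccont g z -> ccont (fun w => (f w + g w)%C) z.
Proof.
intros Hf Hg e He.
destruct (Hf (e/2)) as [d1 [Hd1 H1]]; [lra|].
destruct (Hg (e/2)) as [d2 [Hd2 H2]]; [lra|].
exists (Rmin d1 d2); split; [apply Rmin_glb_lt; auto|].
intros w Hw.
specialize (H1 w (Rlt_le_trans _ _ _ Hw (Rmin_l _ _))).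
specialize (H2 w (Rlt_le_trans _ _ _ Hw (Rmin_r _ _))).
replace (f w + g w - (f z + g z))%C with ((f w - f z) + (g w - g z))%C by ring.
eapply Rle_lt_trans; [apply Cmod_triangle|]. lra.
Qed.

Lemma ccont_mult (f g : C -> C) (z : C) :
  ccont f z -> ccont g z -> ccont (fun w => (f w * g w)%C) z.
Proof.
intros Hf Hg e He.
pose (M := Cmod (f z) + Cmod (g z) + 1).
assert (HM : 0 < M) by (unfold M; generalize (Cmod_ge_0 (f z)) (Cmod_ge_0 (g z)); lra).
(* The bound by 1 keeps [Cmod (f w)] below [M] near [z]. *)
destruct (Hf (Rmin 1 (e/(2*M)))) as [d1 [Hd1 H1]].
{ apply Rmin_glb_lt; [lra|]. apply Rdiv_lt_0_compat; lra. }
destruct (Hg (e/(2*M))) as [d2 [Hd2 H2]]; [apply Rdiv_lt_0_compat; lra|].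
exists (Rmin d1 d2); split; [apply Rmin_glb_lt; auto|].
intros w Hw.
specialize (H1 w (Rlt_le_trans _ _ _ Hw (Rmin_l _ _))).
specialize (H2 w (Rlt_le_trans _ _ _ Hw (Rmin_r _ _))).
assert (H1a := Rlt_le_trans _ _ _ H1 (Rmin_l _ _)).
assert (H1b := Rlt_le_trans _ _ _ H1 (Rmin_r _ _)).
replace (f w * g w - f z * g z)%C with ((f w - f z) * g z + f w * (g w - g z))%C by ring.
eapply Rle_lt_trans; [apply Cmod_triangle|]. rewrite !Cmod_mult.
assert (Hfw := Cmod_minus_triangle (f w) (f z)).
assert (E : e = e/(2*M) * M + M * (e/(2*M))) by (field; lra).
rewrite E.
assert (Cmod (f w - f z) * Cmod (g z) <= e / (2*M) * M).
{ apply Rmult_le_compat; try apply Cmod_ge_0; try lra.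
  unfold M; generalize (Cmod_ge_0 (f z)); lra. }
assert (Cmod (f w) * Cmod (g w - g z) < M * (e / (2*M))); [|lra].
apply Rle_lt_trans with (M * Cmod (g w - g z)).
- apply Rmult_le_compat_r; [apply Cmod_ge_0|].
  unfold M; generalize (Cmod_ge_0 (g z)); lra.
- apply Rmult_lt_compat_l; lra.
Qed.

Lemma ccont_comp (f g : C -> C) (z : C) :
  ccont f (g z) -> ccont g z -> ccont (fun w => f (g w)) z.
Proof.
intros Hf Hg e He.
destruct (Hf e He) as [d [Hd H]]. destruct (Hg d Hd) as [d' [Hd' H']].
exists d'; split; auto.
Qed.

Lemma ccont_neq_0 (f : C -> C) (z : C) : ccont f z -> f z <> 0%C ->
  exists del, 0 < del /\ forall w, Cmod (w - z) < del -> Cmod (f z) / 2 < Cmod (f w).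
Proof.
intros Hf H0. apply Cmod_gt_0 in H0.
destruct (Hf (Cmod (f z) / 2)) as [d [Hd H]]; [lra|].
exists d; split; auto. intros w Hw. specialize (H w Hw).
generalize (Cmod_minus_triangle (f z) (f w)). rewrite Cmod_minus_rev. lra.
Qed.

Lemma ccont_inv (f : C -> C) (z : C) : ccont f z -> f z <> 0%C ->
  ccont (fun w => (/ f w)%C) z.
Proof.
intros Hf H0 e He.
destruct (ccont_neq_0 f z Hf H0) as [d1 [Hd1 H1]].
assert (Hp : 0 < Cmod (f z)) by (apply Cmod_gt_0; exact H0).
pose (m := Cmod (f z)). fold m in H1, Hp.
(* Near [z] the denominator [f w * f z] has modulus at least [m * m / 2]. *)
destruct (Hf (e * (m * m / 2))) as [d2 [Hd2 H2]]; [apply Rmult_lt_0_compat; nra|].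
exists (Rmin d1 d2); split; [apply Rmin_glb_lt; auto|].
intros w Hw.
specialize (H1 w (Rlt_le_trans _ _ _ Hw (Rmin_l _ _))).
specialize (H2 w (Rlt_le_trans _ _ _ Hw (Rmin_r _ _))).
assert (Hw0 : f w <> 0%C) by (apply Cmod_gt_0; lra).
replace (/ f w - / f z)%C with (- (f w - f z) / (f w * f z))%C by (field; split; assumption).
rewrite Cmod_div by (apply Cmult_neq_0; assumption).
rewrite Cmod_opp, Cmod_mult. fold m.
assert (Hden : 0 < Cmod (f w) * m) by (apply Rmult_lt_0_compat; lra).
apply Rmult_lt_reg_r with (Cmod (f w) * m); [exact Hden|].
unfold Rdiv. rewrite Rmult_assoc, Rinv_l, Rmult_1_r by lra.
eapply Rlt_le_trans; [exact H2|]. apply Rmult_le_compat_l; [lra|]. nra.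
Qed.

Lemma ccont_ext_loc (f g : C -> C) (z : C) (d : R) : 0 < d ->
  (forall w, Cmod (w - z) < d -> f w = g w) -> ccont f z -> ccont g z.
Proof.
intros Hd H Hf e He. destruct (Hf e He) as [d' [Hd' H']].
exists (Rmin d d'); split; [apply Rmin_glb_lt; auto|].
intros w Hw. rewrite <- !H; [apply H'| |].
- eapply Rlt_le_trans; [exact Hw|apply Rmin_r].
- rewrite Cmod_self_minus. exact Hd.
- eapply Rlt_le_trans; [exact Hw|apply Rmin_l].
Qed.

Lemma cdiff_ccont (f : C -> C) (z : C) : cdiff f z -> ccont f z.
Proof.
intros [q [Hq [d [Hd H]]]].
apply ccont_ext_loc with (f := fun w => (f z + q w * (w - z))%C) (d := d); auto.
- intros w Hw. symmetry; auto.
- apply ccont_plus; [apply ccont_const|]. apply ccont_mult; auto.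
  apply ccont_plus; [apply ccont_id|]. apply ccont_const.
Qed.

Lemma cdiff_approx (f : C -> C) (z : C) : cdiff f z -> exists l : C,
  forall eps, 0 < eps -> exists del, 0 < del /\
    forall w, Cmod (w - z) < del -> Cmod (f w - f z - (w - z) * l) <= eps * Cmod (w - z).
Proof.
intros [q [Hq [d [Hd H]]]]. exists (q z). intros e He.
destruct (Hq e He) as [d' [Hd' H']].
exists (Rmin d d'); split; [apply Rmin_glb_lt; auto|].
intros w Hw.
rewrite (H w) by (eapply Rlt_le_trans; [exact Hw|apply Rmin_l]).
replace (f z + q w * (w - z) - f z - (w - z) * q z)%C with ((q w - q z) * (w - z))%C by ring.
rewrite Cmod_mult. apply Rmult_le_compat_r; [apply Cmod_ge_0|].
left. apply H'. eapply Rlt_le_trans; [exact Hw|apply Rmin_r].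
Qed.

(** The function [q] is the difference quotient, filled in with [l] at [z]; the error estimate is
    its continuity at [z]. *)
Lemma approx_cdiff (f : C -> C) (z l : C) :
  (forall eps, 0 < eps -> exists del, 0 < del /\
    forall w, Cmod (w - z) < del -> Cmod (f w - f z - (w - z) * l) <= eps * Cmod (w - z)) ->
  cdiff f z.
Proof.
intros H.
exists (fun w => if excluded_middle_informative (w = z) then l else ((f w - f z) / (w - z))%C).
assert (Hne : forall w, w <> z -> (w - z)%C <> 0%C).
{ intros w Hw E. apply Hw. replace w with ((w - z) + z)%C by ring. rewrite E. ring. }
split.
- intros e He. destruct (H (e/2)) as [d [Hd H']]; [lra|].
  exists d; split; auto. intros w Hw.
  destruct (excluded_middle_informative (z = z)) as [_|n]; [|now destruct n].
  destruct (excluded_middle_informative (w = z)) as [E|E].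
  + rewrite Cmod_self_minus. exact He.
  + specialize (H' w Hw). specialize (Hne w E).
    replace ((f w - f z) / (w - z) - l)%C with ((f w - f z - (w - z) * l) / (w - z))%C
      by (field; exact Hne).
    rewrite Cmod_div by exact Hne.
    apply Cmod_gt_0 in Hne.
    apply Rle_lt_trans with (e/2); [|lra].
    apply Rmult_le_reg_r with (Cmod (w - z)); [exact Hne|].
    unfold Rdiv at 1. rewrite Rmult_assoc, Rinv_l, Rmult_1_r by lra. exact H'.
- exists 1; split; [lra|]. intros w _.
  destruct (excluded_middle_informative (w = z)) as [E|E].
  + subst w. ring.
  + field. auto.
Qed.

Lemma ex_derive_cdiff (f : C -> C) (z : C) : @ex_derive C_AbsRing C_NormedModule f z <-> cdiff f z.
Proof.
split.
- intros [l Hl]. apply approx_cdiff with l. apply is_derive_C_iff. exact Hl.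
- intros H. destruct (cdiff_approx f z H) as [l Hl]. exists l. apply is_derive_C_iff. exact Hl.
Qed.

Lemma cdiff_const (c z : C) : cdiff (fun _ => c) z.
Proof.
exists (fun _ => 0%C). split; [apply ccont_const|].
exists 1; split; [lra|]. intros; ring.
Qed.

Lemma cdiff_id (z : C) : cdiff (fun w => w) z.
Proof.
exists (fun _ => 1%C). split; [apply ccont_const|].
exists 1; split; [lra|]. intros; ring.
Qed.

Lemma cdiff_plus (f g : C -> C) (z : C) :
  cdiff f z -> cdiff g z -> cdiff (fun w => (f w + g w)%C) z.
Proof.
intros [q [Hq [d [Hd H]]]] [q' [Hq' [d' [Hd' H']]]].
exists (fun w => (q w + q' w)%C). split; [now apply ccont_plus|].
exists (Rmin d d'); split; [apply Rmin_glb_lt; auto|].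
intros w Hw.
rewrite (H w) by (eapply Rlt_le_trans; [exact Hw|apply Rmin_l]).
rewrite (H' w) by (eapply Rlt_le_trans; [exact Hw|apply Rmin_r]). ring.
Qed.

Lemma cdiff_mult (f g : C -> C) (z : C) :
  cdiff f z -> cdiff g z -> cdiff (fun w => (f w * g w)%C) z.
Proof.
intros Hf Hg. assert (Hc := cdiff_ccont g z Hg). revert Hf Hg.
intros [q [Hq [d [Hd H]]]] [q' [Hq' [d' [Hd' H']]]].
exists (fun w => (q w * g w + f z * q' w)%C). split.
- apply ccont_plus; apply ccont_mult; auto. apply ccont_const.
- exists (Rmin d d'); split; [apply Rmin_glb_lt; auto|].
  intros w Hw.
  rewrite (H w) by (eapply Rlt_le_trans; [exact Hw|apply Rmin_l]).
  rewrite (H' w) by (eapply Rlt_le_trans; [exact Hw|apply Rmin_r]). ring.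
Qed.

Lemma cdiff_comp (f g : C -> C) (z : C) :
  cdiff f (g z) -> cdiff g z -> cdiff (fun w => f (g w)) z.
Proof.
intros Hf Hg. assert (Hc := cdiff_ccont g z Hg). revert Hf Hg.
intros [q [Hq [d [Hd H]]]] [q' [Hq' [d' [Hd' H']]]].
exists (fun w => (q (g w) * q' w)%C). split.
- apply ccont_mult; auto. apply (ccont_comp q g z); auto.
- destruct (Hc d Hd) as [d2 [Hd2 H2]].
  exists (Rmin d2 d'); split; [apply Rmin_glb_lt; auto|].
  intros w Hw.
  rewrite (H (g w)) by (apply H2; eapply Rlt_le_trans; [exact Hw|apply Rmin_l]).
  rewrite (H' w) at 2 by (eapply Rlt_le_trans; [exact Hw|apply Rmin_r]). ring.
Qed.

Lemma cdiff_inv (f : C -> C) (z : C) : cdiff f z -> f z <> 0%C ->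
  cdiff (fun w => (/ f w)%C) z.
Proof.
intros Hf H0. assert (Hc := cdiff_ccont f z Hf). revert Hf.
intros [q [Hq [d [Hd H]]]].
exists (fun w => (- (1) * q w * (/ f w * / f z))%C). split.
- repeat apply ccont_mult; auto; try apply ccont_const. now apply ccont_inv.
- destruct (ccont_neq_0 f z Hc H0) as [d1 [Hd1 H1]].
  exists (Rmin d d1); split; [apply Rmin_glb_lt; auto|].
  intros w Hw.
  assert (Hw0 : f w <> 0%C).
  { apply Cmod_gt_0. eapply Rlt_trans; [|apply H1; eapply Rlt_le_trans; [exact Hw|apply Rmin_r]].
    apply Cmod_gt_0 in H0. lra. }
  assert (E := H w (Rlt_le_trans _ _ _ Hw (Rmin_l _ _))).
  replace (- (1) * q w * (/ f w * / f z) * (w - z))%C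
    with (- (q w * (w - z)) * (/ f w * / f z))%C by ring.
  replace (q w * (w - z))%C with (f w - f z)%C by (rewrite E; ring).
  field. split; assumption.
Qed.

Lemma cdiff_pow (f : C -> C) (n : nat) (z : C) :
  cdiff f z -> cdiff (fun w => (f w ^ n)%C) z.
Proof.
intros Hf. induction n as [|n IH]; simpl.
- apply cdiff_const.
- now apply cdiff_mult.
Qed.

(** * The complex exponential *)

Definition cexp (w : C) : C := (exp (Re w) * cos (Im w), exp (Re w) * sin (Im w)).

Lemma cexp_plus (v w : C) : cexp (v + w) = (cexp v * cexp w)%C.
Proof.
destruct v as [a b], w as [c d]. unfold cexp, Cmult; simpl.
rewrite exp_plus, cos_plus, sin_plus. f_equal; ring.
Qed.

Lemma Cmod_cexp (w : C) : Cmod (cexp w) = exp (Re w).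
Proof.
unfold cexp, Cmod; simpl.
assert (E := sin2_cos2 (Im w)). unfold Rsqr in E.
replace (_ + _) with (exp (Re w) * exp (Re w)).
- apply sqrt_square. left; apply exp_pos.
- replace (exp (Re w) * exp (Re w)) with
    (exp (Re w) * exp (Re w) * (sin (Im w) * sin (Im w) + cos (Im w) * cos (Im w)))
    by (rewrite E; ring). ring.
Qed.

Lemma cexp_neq_0 (w : C) : cexp w <> 0%C.
Proof. apply Cmod_gt_0. rewrite Cmod_cexp. apply exp_pos. Qed.

Lemma Im_le_Cmod (z : C) : Rabs (Im z) <= Cmod z.
Proof. eapply Rle_trans; [|apply Rmax_Cmod]. apply Rmax_r. Qed.

Lemma Cmod_le_sum (z : C) : Cmod z <= Rabs (Re z) + Rabs (Im z).
Proof.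
replace z with ((Re z : C) + Ci * (Im z : C))%C at 1.
- eapply Rle_trans; [apply Cmod_triangle|].
  rewrite Cmod_mult, Cmod_Ci, !Cmod_R. lra.
- destruct z as [a b]. unfold Cplus, Cmult, Ci, RtoC; simpl. f_equal; ring.
Qed.

Lemma derivable_pt_lim_approx0 (f : R -> R) (l : R) : derivable_pt_lim f 0 l ->
  forall eps, 0 < eps -> exists del, 0 < del /\
    forall h, Rabs h < del -> Rabs (f h - f 0 - l * h) <= eps * Rabs h.
Proof.
intros H e He. destruct (H e He) as [d Hd].
exists d; split; [apply cond_pos|]. intros h Hh.
destruct (Req_dec h 0) as [E|E].
- subst h. rewrite Rmult_0_r, !Rminus_diag, Rabs_R0. lra.
- specialize (Hd h E Hh). rewrite Rplus_0_l in Hd.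
  replace (f h - f 0 - l * h) with (((f h - f 0) / h - l) * h) by (field; exact E).
  rewrite Rabs_mult. apply Rmult_le_compat_r; [apply Rabs_pos|lra].
Qed.

Lemma cexp_approx0 (eps : R) : 0 < eps -> exists del, 0 < del /\
  forall h, Cmod h < del -> Cmod (cexp h - 1 - h) <= eps * Cmod h.
Proof.
intros He.
(* The real part of the error will cost [4 * (e * m)] and the imaginary part [5 * (e * m)], hence
   the tenth. The bound [e <= 1] keeps [exp a] below 3. *)
pose (e := Rmin 1 (eps / 10)).
assert (He0 : 0 < e) by (apply Rmin_glb_lt; lra).
assert (He1 : e <= 1) by apply Rmin_l.
assert (He2 : e <= eps / 10) by apply Rmin_r.
destruct (derivable_pt_lim_approx0 exp 1) with (eps := e) as [d1 [Hd1 H1]]; auto.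
{ generalize (derivable_pt_lim_exp 0). rewrite exp_0. auto. }
destruct (derivable_pt_lim_approx0 cos 0) with (eps := e) as [d2 [Hd2 H2]]; auto.
{ generalize (derivable_pt_lim_cos 0). rewrite sin_0, Ropp_0. auto. }
destruct (derivable_pt_lim_approx0 sin 1) with (eps := e) as [d3 [Hd3 H3]]; auto.
{ generalize (derivable_pt_lim_sin 0). rewrite cos_0. auto. }
rewrite exp_0 in H1. rewrite cos_0 in H2. rewrite sin_0 in H3.
exists (Rmin e (Rmin d1 (Rmin d2 d3))). split; [do 3 (apply Rmin_glb_lt; [assumption|]); assumption|].
intros h Hh.
assert (G1 := Rlt_le_trans _ _ _ Hh (Rmin_l _ _)).
assert (G2 := Rlt_le_trans _ _ _ Hh (Rmin_r _ _)).
assert (G3 := Rlt_le_trans _ _ _ G2 (Rmin_l _ _)).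
assert (G4 := Rlt_le_trans _ _ _ G2 (Rmin_r _ _)).
assert (G5 := Rlt_le_trans _ _ _ G4 (Rmin_l _ _)).
assert (G6 := Rlt_le_trans _ _ _ G4 (Rmin_r _ _)).
assert (Ha := re_le_Cmod h). assert (Hb := Im_le_Cmod h).
eapply Rle_trans; [apply Cmod_le_sum|].
unfold cexp. destruct h as [a b]. simpl in *.
set (m := Cmod (a, b)) in *.
assert (B1 := H1 a ltac:(lra)). assert (B2 := H2 b ltac:(lra)). assert (B3 := H3 b ltac:(lra)).
assert (Hm := Rle_trans _ _ _ (Rabs_pos _) Ha).
assert (Hea : Rabs (exp a - 1) <= 2 * m).
{ replace (exp a - 1) with ((exp a - 1 - 1 * a) + a) by ring.
  eapply Rle_trans; [apply Rabs_triang|]. generalize (Rabs_pos a). nra. }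
assert (Hex : Rabs (exp a) <= 3).
{ replace (exp a) with ((exp a - 1) + 1) by ring.
  eapply Rle_trans; [apply Rabs_triang|]. rewrite Rabs_R1. lra. }
assert (P1 : Rabs (exp a * cos b + - (1) + - a) <= 4 * (e * m)).
{ replace (exp a * cos b + - (1) + - a) with
    (exp a * (cos b - 1 - 0 * b) + (exp a - 1 - 1 * a)) by ring.
  eapply Rle_trans; [apply Rabs_triang|]. rewrite Rabs_mult.
  assert (Rabs (exp a) * Rabs (cos b - 1 - 0 * b) <= 3 * (e * m)).
  { apply Rmult_le_compat; try apply Rabs_pos; auto.
    eapply Rle_trans; [exact B2|]. apply Rmult_le_compat_l; lra. }
  assert (e * Rabs a <= e * m) by (apply Rmult_le_compat_l; lra). lra. }
assert (P2 : Rabs (exp a * sin b + - 0 + - b) <= 5 * (e * m)).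
{ replace (exp a * sin b + - 0 + - b) with
    (exp a * (sin b - 0 - 1 * b) + (exp a - 1) * b) by ring.
  eapply Rle_trans; [apply Rabs_triang|]. rewrite !Rabs_mult.
  assert (Rabs (exp a) * Rabs (sin b - 0 - 1 * b) <= 3 * (e * m)).
  { apply Rmult_le_compat; try apply Rabs_pos; auto.
    eapply Rle_trans; [exact B3|]. apply Rmult_le_compat_l; lra. }
  assert (Rabs (exp a - 1) * Rabs b <= (2 * e) * m).
  { apply Rmult_le_compat; try apply Rabs_pos; lra. }
  lra. }
assert (0 <= eps * m) by (apply Rmult_le_pos; lra).
assert (e * m <= eps / 10 * m) by (apply Rmult_le_compat_r; lra).
lra.
Qed.

Lemma cdiff_cexp (w : C) : cdiff cexp w.
Proof.
apply approx_cdiff with (cexp w). intros e He.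
assert (Hp : 0 < Cmod (cexp w)) by (rewrite Cmod_cexp; apply exp_pos).
destruct (cexp_approx0 (e / Cmod (cexp w))) as [d [Hd H]]; [apply Rdiv_lt_0_compat; auto|].
exists d; split; auto. intros v Hv. specialize (H _ Hv).
replace (cexp v) with (cexp w * cexp (v - w))%C by (rewrite <- cexp_plus; f_equal; ring).
replace (cexp w * cexp (v - w) - cexp w - (v - w) * cexp w)%C
  with (cexp w * (cexp (v - w) - 1 - (v - w)))%C by ring.
rewrite Cmod_mult.
replace (e * Cmod (v - w)) with (Cmod (cexp w) * (e / Cmod (cexp w) * Cmod (v - w)))
  by (field; lra).
apply Rmult_le_compat_l; lra.
Qed.

(** * Goursat's theorem for rectangles *)

(** Complex integrals are pairs of real integrals here, so continuity is recorded for each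
    coordinate. *)
Definition pcont (G : R -> C) (t : R) : Prop :=
  continuous (fun u => Re (G u)) t /\ continuous (fun u => Im (G u)) t.

Definition CI (G : R -> C) (a b : R) : C :=
  (RInt (fun t => Re (G t)) a b, RInt (fun t => Im (G t)) a b).

Lemma continuous_eps (f : R -> R) (t : R) :
  (forall eps, 0 < eps -> exists del, 0 < del /\
     forall u, Rabs (u - t) < del -> Rabs (f u - f t) < eps) -> continuous f t.
Proof.
intros H P [e He]. destruct (H e (cond_pos e)) as [d [Hd Hd']].
exists (mkposreal d Hd). intros u Hu. apply He. exact (Hd' u Hu).
Qed.

Lemma pcont_minus (G H : R -> C) (t : R) : pcont G t -> pcont H t ->
  pcont (fun u => (G u - H u)%C) t.
Proof.
intros [G1 G2] [H1 H2]. split.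
- exact (continuous_minus (fun u => Re (G u)) (fun u => Re (H u)) t G1 H1).
- exact (continuous_minus (fun u => Im (G u)) (fun u => Im (H u)) t G2 H2).
Qed.

Lemma ccont_pcont (F : C -> C) (g : R -> C) (t : R) :
  (forall u v, Cmod (g u - g v) <= Rabs (u - v)) -> ccont F (g t) ->
  pcont (fun u => F (g u)) t.
Proof.
intros Hg HF. split; apply continuous_eps; intros e He; destruct (HF e He) as [d [Hd H]];
  exists d; split; auto; intros u Hu;
  (eapply Rle_lt_trans; [|apply (H (g u)); eapply Rle_lt_trans; [apply Hg|exact Hu]]).
- exact (re_le_Cmod (F (g u) - F (g t))%C).
- exact (Im_le_Cmod (F (g u) - F (g t))%C).
Qed.

Lemma ccont_pcont_v (F : C -> C) (s t : R) : ccont F (s, t) -> pcont (fun u => F (s, u)) t.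
Proof.
apply (ccont_pcont F (fun u => (s, u))). intros u v.
eapply Rle_trans; [apply Cmod_le_sum|]. simpl.
replace (s + - s) with 0 by ring. rewrite Rabs_R0. unfold Rminus. lra.
Qed.

Lemma ccont_pcont_h (F : C -> C) (s t : R) : ccont F (s, t) -> pcont (fun u => F (u, t)) s.
Proof.
apply (ccont_pcont F (fun u => (u, t))). intros u v.
eapply Rle_trans; [apply Cmod_le_sum|]. simpl.
replace (t + - t) with 0 by ring. rewrite Rabs_R0. unfold Rminus. lra.
Qed.

Section Integral.
Variables (a b : R) (Hab : a <= b).

Lemma pcont_ex_RInt (G : R -> C) : (forall t, a <= t <= b -> pcont G t) ->
  ex_RInt (fun t => Re (G t)) a b /\ ex_RInt (fun t => Im (G t)) a b.
Proof.
intros HG. split; apply (ex_RInt_continuous (V := R_CompleteNormedModule)); intros t Ht;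
  rewrite Rmin_left, Rmax_right in Ht by exact Hab; apply HG; exact Ht.
Qed.

Lemma CI_plus (G H : R -> C) :
  (forall t, a <= t <= b -> pcont G t) -> (forall t, a <= t <= b -> pcont H t) ->
  CI (fun t => (G t + H t)%C) a b = (CI G a b + CI H a b)%C.
Proof.
intros HG HH. destruct (pcont_ex_RInt G HG), (pcont_ex_RInt H HH).
unfold CI, Cplus; simpl. f_equal; apply (RInt_plus (V := R_CompleteNormedModule)); auto.
Qed.

Lemma CI_minus (G H : R -> C) :
  (forall t, a <= t <= b -> pcont G t) -> (forall t, a <= t <= b -> pcont H t) ->
  CI (fun t => (G t - H t)%C) a b = (CI G a b - CI H a b)%C.
Proof.
intros HG HH. destruct (pcont_ex_RInt G HG), (pcont_ex_RInt H HH).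
unfold CI, Cminus, Cplus, Copp; simpl.
f_equal; apply (RInt_minus (V := R_CompleteNormedModule)); auto.
Qed.

Lemma CI_scal (c : C) (G : R -> C) : (forall t, a <= t <= b -> pcont G t) ->
  CI (fun t => (c * G t)%C) a b = (c * CI G a b)%C.
Proof.
intros HG. destruct (pcont_ex_RInt G HG) as [H1 H2].
assert (S : forall k f, ex_RInt f a b -> ex_RInt (fun t => k * f t) a b)
  by (intros k f Hf; exact (ex_RInt_scal (V := R_NormedModule) f a b k Hf)).
assert (I : forall k f, ex_RInt f a b -> RInt (fun t => k * f t) a b = k * RInt f a b)
  by (intros k f Hf; exact (RInt_scal (V := R_CompleteNormedModule) f a b k Hf)).
unfold CI, Cmult; simpl. rewrite <- !I by assumption.
f_equal.
- exact (RInt_minus (V := R_CompleteNormedModule) _ _ a b (S (fst c) _ H1) (S (snd c) _ H2)).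
- exact (RInt_plus (V := R_CompleteNormedModule) _ _ a b (S (fst c) _ H2) (S (snd c) _ H1)).
Qed.

Lemma CI_ext (G H : R -> C) : (forall t, a <= t <= b -> G t = H t) -> CI G a b = CI H a b.
Proof.
intros E. unfold CI. f_equal; apply (RInt_ext (V := R_CompleteNormedModule)); intros t Ht;
  rewrite Rmin_left, Rmax_right in Ht by exact Hab; rewrite E; auto; lra.
Qed.

Lemma RInt_near (f : R -> R) (k M : R) : ex_RInt f a b ->
  (forall t, a <= t <= b -> Rabs (f t - k) <= M) ->
  Rabs (RInt f a b - k * (b - a)) <= M * (b - a).
Proof.
intros Hf HM.
replace (k * (b - a)) with (RInt (fun _ => k) a b)
  by (rewrite RInt_const; unfold scal; simpl; unfold mult; simpl; ring).
replace (RInt f a b - RInt (fun _ => k) a b) with (RInt (fun t => f t - k) a b)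
  by exact (RInt_minus (V := R_CompleteNormedModule) f (fun _ => k) a b Hf (ex_RInt_const _ _ _)).
rewrite Rmult_comm. apply abs_RInt_le_const; auto.
exact (ex_RInt_minus (V := R_NormedModule) f (fun _ => k) a b Hf (ex_RInt_const _ _ _)).
Qed.

(** The factor 2 is the price of estimating the two coordinates separately. It is harmless, since
    only orders of magnitude matter below. *)
Lemma CI_near (G : R -> C) (K : C) (M : R) : (forall t, a <= t <= b -> pcont G t) ->
  (forall t, a <= t <= b -> Cmod (G t - K) <= M) ->
  Cmod (CI G a b - K * (b - a)%R) <= 2 * M * (b - a).
Proof.
intros HG HM. destruct (pcont_ex_RInt G HG) as [H1 H2].
assert (N1 := RInt_near _ (Re K) M H1
  (fun t Ht => Rle_trans _ _ _ (re_le_Cmod (G t - K)%C) (HM t Ht))).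
assert (N2 := RInt_near _ (Im K) M H2
  (fun t Ht => Rle_trans _ _ _ (Im_le_Cmod (G t - K)%C) (HM t Ht))).
eapply Rle_trans; [apply Cmod_le_sum|].
unfold CI. destruct K as [k1 k2]. unfold Cminus, Cplus, Copp, Cmult, RtoC; simpl in *.
rewrite !Rmult_0_r, !Rminus_0_r, Rplus_0_l. unfold Rminus in *. lra.
Qed.

Lemma CI_bound (G : R -> C) (M : R) : (forall t, a <= t <= b -> pcont G t) ->
  (forall t, a <= t <= b -> Cmod (G t) <= M) -> Cmod (CI G a b) <= 2 * M * (b - a).
Proof.
intros HG HM.
replace (CI G a b) with (CI G a b - 0 * (b - a)%R)%C by ring.
apply CI_near; auto. intros t Ht. replace (G t - 0)%C with (G t) by ring. auto.
Qed.

Lemma CI_const (c : C) : CI (fun _ => c) a b = (c * (b - a)%R)%C.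
Proof.
unfold CI. rewrite !RInt_const. unfold scal; simpl; unfold mult; simpl.
destruct c; unfold Cmult, RtoC; simpl. f_equal; ring.
Qed.

End Integral.

Lemma CI_Chasles (G : R -> C) (a b c : R) : a <= b -> b <= c ->
  (forall t, a <= t <= c -> pcont G t) -> CI G a c = (CI G a b + CI G b c)%C.
Proof.
intros Hab Hbc HG.
destruct (pcont_ex_RInt a b Hab G) as [H1 H2]; [intros t Ht; apply HG; lra|].
destruct (pcont_ex_RInt b c Hbc G) as [H3 H4]; [intros t Ht; apply HG; lra|].
unfold CI, Cplus; simpl. f_equal; symmetry; apply (RInt_Chasles (V := R_CompleteNormedModule)); auto.
Qed.

(** The counterclockwise contour integral around the rectangle, with opposite sides paired: [dz] is
    [i dt] on the vertical sides and [ds] on the horizontal ones. Pairing makes both the periodic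
    and the affine case easy. *)
Definition boundary_integral (F : C -> C) (a b c d : R) : C :=
  (Ci * CI (fun t => (F (b, t) - F (a, t))%C) c d - CI (fun s => (F (s, d) - F (s, c))%C) a b)%C.

Lemma boundary_integral_split_h (F : C -> C) (a m b c d : R) : a <= m -> m <= b -> c <= d ->
  (forall s t, a <= s <= b -> c <= t <= d -> ccont F (s, t)) ->
  boundary_integral F a b c d = (boundary_integral F a m c d + boundary_integral F m b c d)%C.
Proof.
intros Ham Hmb Hcd HF. unfold boundary_integral.
rewrite (CI_Chasles _ a m b) by (auto; intros t Ht; apply pcont_minus; apply ccont_pcont_h; apply HF; lra).
rewrite (CI_ext c d Hcd (fun t => (F (b, t) - F (a, t))%C)
  (fun t => ((F (m, t) - F (a, t)) + (F (b, t) - F (m, t)))%C)) by (intros; ring).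
rewrite CI_plus by (auto; intros t Ht; apply pcont_minus; apply ccont_pcont_v; apply HF; lra).
ring.
Qed.

Lemma boundary_integral_split_v (F : C -> C) (a b c n d : R) : a <= b -> c <= n -> n <= d ->
  (forall s t, a <= s <= b -> c <= t <= d -> ccont F (s, t)) ->
  boundary_integral F a b c d = (boundary_integral F a b c n + boundary_integral F a b n d)%C.
Proof.
intros Hab Hcn Hnd HF. unfold boundary_integral.
rewrite (CI_Chasles _ c n d) by (auto; intros t Ht; apply pcont_minus; apply ccont_pcont_v; apply HF; lra).
rewrite (CI_ext a b Hab (fun s => (F (s, d) - F (s, c))%C)
  (fun s => ((F (s, n) - F (s, c)) + (F (s, d) - F (s, n)))%C)) by (intros; ring).
rewrite CI_plus by (auto; intros t Ht; apply pcont_minus; apply ccont_pcont_h; apply HF; lra).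
ring.
Qed.

Lemma boundary_integral_quarter (F : C -> C) (a c l h E : R) : 0 <= l -> 0 <= h ->
  (forall s t, a <= s <= a + l -> c <= t <= c + h -> ccont F (s, t)) ->
  E <= Cmod (boundary_integral F a (a + l) c (c + h)) ->
  exists a' c', (a' = a \/ a' = a + l / 2) /\ (c' = c \/ c' = c + h / 2) /\
    E / 4 <= Cmod (boundary_integral F a' (a' + l / 2) c' (c' + h / 2)).
Proof.
intros Hl Hh HF HE.
apply NNPP; intros Hn.
assert (L : forall a' c', (a' = a \/ a' = a + l / 2) -> (c' = c \/ c' = c + h / 2) ->
  Cmod (boundary_integral F a' (a' + l / 2) c' (c' + h / 2)) < E / 4).
{ intros a' c' H1 H2. apply Rnot_le_lt. intros H3. apply Hn. exists a', c'. auto. }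
rewrite (boundary_integral_split_h F a (a + l / 2)) in HE by (auto; lra).
rewrite (boundary_integral_split_v F a (a + l / 2) c (c + h / 2)) in HE
  by (try lra; intros; apply HF; lra).
rewrite (boundary_integral_split_v F (a + l / 2) (a + l) c (c + h / 2)) in HE
  by (try lra; intros; apply HF; lra).
assert (L1 := L a c ltac:(auto) ltac:(auto)).
assert (L2 := L a (c + h / 2) ltac:(auto) ltac:(auto)).
assert (L3 := L (a + l / 2) c ltac:(auto) ltac:(auto)).
assert (L4 := L (a + l / 2) (c + h / 2) ltac:(auto) ltac:(auto)).
replace (c + h / 2 + h / 2) with (c + h) in * by field.
replace (a + l / 2 + l / 2) with (a + l) in * by field.
eapply Rle_not_lt; [exact HE|].
eapply Rle_lt_trans; [apply Cmod_triangle|].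
eapply Rle_lt_trans; [apply Rplus_le_compat; apply Cmod_triangle|].
lra.
Qed.

(** For an affine function the paired differences are the constants [(b - a) l] and [i (d - c) l],
    and the two integrals cancel. An error [M] in the values doubles in the differences, and doubles
    again in [CI_near]. *)
Lemma boundary_integral_affine_approx (F : C -> C) (p l : C) (a b c d M : R) :
  a <= b -> c <= d ->
  (forall s t, a <= s <= b -> c <= t <= d -> ccont F (s, t)) ->
  (forall s t, a <= s <= b -> c <= t <= d ->
     Cmod (F (s, t) - F p - ((s, t) - p) * l)%C <= M) ->
  Cmod (boundary_integral F a b c d) <= 4 * M * ((b - a) + (d - c)).
Proof.
intros Hab Hcd HF HM. unfold boundary_integral.
assert (Hd : forall s t s' t', a <= s <= b -> c <= t <= d -> a <= s' <= b -> c <= t' <= d ->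
  Cmod (F (s, t) - F (s', t') - ((s, t) - (s', t')) * l)%C <= 2 * M).
{ intros s t s' t' H1 H2 H3 H4.
  replace (F (s, t) - F (s', t') - ((s, t) - (s', t')) * l)%C
    with ((F (s, t) - F p - ((s, t) - p) * l) - (F (s', t') - F p - ((s', t') - p) * l))%C by ring.
  eapply Rle_trans; [apply Cmod_minus_le|].
  generalize (HM s t H1 H2) (HM s' t' H3 H4). lra. }
assert (B1 : Cmod (CI (fun t => (F (b, t) - F (a, t))%C) c d - (b - a)%R * l * (d - c)%R)
  <= 2 * (2 * M) * (d - c)).
{ apply CI_near; auto.
  - intros t Ht; apply pcont_minus; apply ccont_pcont_v; apply HF; lra.
  - intros t Ht. replace (RtoC (b - a)) with ((b, t) - (a, t))%C
      by (unfold Cminus, Cplus, Copp, RtoC; simpl; f_equal; ring).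
    apply Hd; lra. }
assert (B2 : Cmod (CI (fun s => (F (s, d) - F (s, c))%C) a b - (0, (d - c)%R) * l * (b - a)%R)
  <= 2 * (2 * M) * (b - a)).
{ apply CI_near; auto.
  - intros t Ht; apply pcont_minus; apply ccont_pcont_h; apply HF; lra.
  - intros t Ht. replace ((0, d - c) : C) with ((t, d) - (t, c))%C
      by (unfold Cminus, Cplus, Copp, RtoC; simpl; f_equal; ring).
    apply Hd; lra. }
match goal with |- Cmod (Ci * ?X - ?Y) <= _ =>
  replace (Ci * X - Y)%C with (Ci * (X - (b - a)%R * l * (d - c)%R) - (Y - (0, (d - c)%R) * l * (b - a)%R))%C
end.
- eapply Rle_trans; [apply Cmod_minus_le|]. rewrite Cmod_mult, Cmod_Ci. lra.
- replace ((0, d - c) : C) with (Ci * (d - c)%R)%C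
    by (unfold Ci, Cmult, RtoC; simpl; f_equal; ring).
  ring.
Qed.

(** The point is the supremum of the left ends, since each right end bounds all of them. *)
Lemma nested_intervals (x l : nat -> R) :
  (forall n, 0 <= l n) ->
  (forall n, x n <= x (S n) /\ x (S n) + l (S n) <= x n + l n) ->
  exists p, forall n, x n <= p <= x n + l n.
Proof.
intros Hl H.
assert (M : forall n k, x n <= x (n + k)%nat /\ x (n + k)%nat + l (n + k)%nat <= x n + l n).
{ intros n k. induction k as [|k IH].
  - rewrite Nat.add_0_r. lra.
  - rewrite Nat.add_succ_r. destruct (H (n + k)%nat). lra. }
assert (B : forall n m, x m <= x n + l n).
{ intros n m. destruct (Nat.le_ge_cases n m) as [L|L].
  - replace m with (n + (m - n))%nat by lia. destruct (M n (m - n)%nat).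
    generalize (Hl (n + (m - n))%nat). lra.
  - replace n with (m + (n - m))%nat by lia. destruct (M m (n - m)%nat).
    generalize (Hl (m + (n - m))%nat). lra. }
destruct (completeness (fun y => exists n, y = x n)) as [p [Hp1 Hp2]].
- exists (x 0%nat + l 0%nat). intros y [n ->]. apply B.
- exists (x 0%nat). now exists 0%nat.
- exists p. intros n. split.
  + apply Hp1. now exists n.
  + apply Hp2. intros y [m ->]. apply B.
Qed.

Lemma goursat (F : C -> C) (a l c h : R) : 0 <= l -> 0 <= h ->
  (forall s t, a <= s <= a + l -> c <= t <= c + h -> cdiff F (s, t)) ->
  boundary_integral F a (a + l) c (c + h) = 0%C.
Proof.
intros Hl Hh HF. apply Cmod_eq_0.
set (E := Cmod (boundary_integral F a (a + l) c (c + h))).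
assert (HE : 0 <= E) by apply Cmod_ge_0.
pose (l_ := fun n => l / 2 ^ n). pose (h_ := fun n => h / 2 ^ n).
assert (P2 : forall n, 0 < 2 ^ n) by (intros; apply pow_lt; lra).
assert (Hl_ : forall n, 0 <= l_ n) by (intros n; apply Rdiv_le_0_compat; auto).
assert (Hh_ : forall n, 0 <= h_ n) by (intros n; apply Rdiv_le_0_compat; auto).
assert (Sl : forall n, l_ (S n) = l_ n / 2) by (intros n; unfold l_; simpl; field; apply Rgt_not_eq, P2).
assert (Sh : forall n, h_ (S n) = h_ n / 2) by (intros n; unfold h_; simpl; field; apply Rgt_not_eq, P2).
(* The corner [x] gives a rectangle of generation [n] inside the original one that still carries the
   share [E / 4 ^ n] of the integral. *)
pose (P := fun (n : nat) (x : R * R) =>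
  a <= fst x /\ fst x + l_ n <= a + l /\ c <= snd x /\ snd x + h_ n <= c + h /\
  E / 4 ^ n <= Cmod (boundary_integral F (fst x) (fst x + l_ n) (snd x) (snd x + h_ n))).
assert (Hstep : forall n (x : {x | P n x}), exists y : {y | P (S n) y},
  (fst (proj1_sig x) <= fst (proj1_sig y) /\
   fst (proj1_sig y) + l_ (S n) <= fst (proj1_sig x) + l_ n) /\
  (snd (proj1_sig x) <= snd (proj1_sig y) /\
   snd (proj1_sig y) + h_ (S n) <= snd (proj1_sig x) + h_ n)).
{ intros n [[x y] [H1 [H2 [H3 [H4 H5]]]]]. simpl in *.
  destruct (boundary_integral_quarter F x y (l_ n) (h_ n) (E / 4 ^ n)) as [x' [y' [Hx [Hy HQ]]]]; auto.
  { intros s t Hs Ht. apply cdiff_ccont, HF; lra. }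
  specialize (Hl_ n). specialize (Hh_ n).
  assert (HP : P (S n) (x', y')).
  { unfold P; simpl. rewrite Sl, Sh. repeat split; try (destruct Hx, Hy; subst; lra).
    replace (E / (4 * 4 ^ n)) with (E / 4 ^ n / 4) by (field; apply pow_nonzero; lra). exact HQ. }
  exists (exist _ (x', y') HP). simpl. rewrite Sl, Sh. destruct Hx, Hy; subst; lra. }
assert (H0 : P 0%nat (a, c)).
{ unfold P, l_, h_; simpl. replace (l / 1) with l by field. replace (h / 1) with h by field.
  unfold Rdiv; rewrite Rinv_1, Rmult_1_r. repeat split; try lra. apply Rle_refl. }
(* Dependent choice: the invariant travels with the corner, so that the next bisection is
   available. *)
pose (sq := fix sq n : {x | P n x} := match n with
  | O => exist _ (a, c) H0
  | S n => proj1_sig (constructive_indefinite_description _ (Hstep n (sq n))) end).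
assert (Hsq : forall n,
  (fst (proj1_sig (sq n)) <= fst (proj1_sig (sq (S n))) /\
   fst (proj1_sig (sq (S n))) + l_ (S n) <= fst (proj1_sig (sq n)) + l_ n) /\
  (snd (proj1_sig (sq n)) <= snd (proj1_sig (sq (S n))) /\
   snd (proj1_sig (sq (S n))) + h_ (S n) <= snd (proj1_sig (sq n)) + h_ n)).
{ intros n. exact (proj2_sig (constructive_indefinite_description _ (Hstep n (sq n)))). }
destruct (nested_intervals (fun n => fst (proj1_sig (sq n))) l_ Hl_) as [p1 Hp1]; [intros n; apply Hsq|].
destruct (nested_intervals (fun n => snd (proj1_sig (sq n))) h_ Hh_) as [p2 Hp2]; [intros n; apply Hsq|].
destruct (cdiff_approx F (p1, p2)) as [d Hd].
{ destruct (proj2_sig (sq 0%nat)) as [H1 [H2 [H3 [H4 _]]]].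
  specialize (Hp1 0%nat). specialize (Hp2 0%nat). cbv beta in Hp1, Hp2. apply HF; lra. }
destruct (Rle_lt_or_eq_dec 0 E HE) as [HEp|]; [exfalso|auto].
pose (D := l + h).
assert (HD : 0 <= D) by (unfold D; lra).
(* The estimate will end in [E <= 4 * eta * (D * D)], which this [eta] contradicts. The [+ 1] covers
   a rectangle reduced to a point. *)
pose (eta := E / (8 * (D * D + 1))).
assert (Heta : 0 < eta) by (apply Rdiv_lt_0_compat; nra).
destruct (Hd eta Heta) as [del [Hdel Happ]].
assert (HN : exists n, D / 2 ^ n < del).
{ destruct (pow_lt_1_zero (/ 2)) with (y := del / (D + 1)) as [N HN].
  - rewrite Rabs_pos_eq; lra.
  - apply Rdiv_lt_0_compat; lra.
  - exists N. specialize (HN N (le_n N)). rewrite Rabs_pos_eq, pow_inv in HN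
      by (apply pow_le; lra).
    apply Rle_lt_trans with ((D + 1) * / 2 ^ N).
    + apply Rmult_le_compat_r; [left; apply Rinv_0_lt_compat, P2|lra].
    + apply Rlt_le_trans with ((D + 1) * (del / (D + 1))); [|right; field; lra].
      apply Rmult_lt_compat_l; lra. }
destruct HN as [n Hn].
destruct (proj2_sig (sq n)) as [H1 [H2 [H3 [H4 H5]]]].
specialize (Hp1 n). specialize (Hp2 n). cbv beta in Hp1, Hp2.
destruct (proj1_sig (sq n)) as [x y]. simpl in *.
assert (Hlh : l_ n + h_ n = D / 2 ^ n) by (unfold l_, h_, D; field; apply Rgt_not_eq, P2).
specialize (Hl_ n). specialize (Hh_ n).
assert (Hdist : forall s t, x <= s <= x + l_ n -> y <= t <= y + h_ n ->
  Cmod ((s, t) - (p1, p2)) <= D / 2 ^ n).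
{ intros s t Hs Ht. eapply Rle_trans; [apply Cmod_le_sum|]. rewrite <- Hlh. simpl.
  apply Rplus_le_compat; apply Rabs_le; lra. }
assert (HB := boundary_integral_affine_approx F (p1, p2) d x (x + l_ n) y (y + h_ n) (eta * (D / 2 ^ n))).
(* The distance to the common point and the half-perimeter both shrink like [2 ^ n]; their product
   matches the loss [4 ^ n] on the left. *)
assert (HB2 : E / 4 ^ n <= 4 * (eta * (D / 2 ^ n)) * (D / 2 ^ n)).
{ eapply Rle_trans; [exact H5|]. rewrite <- Hlh at 2.
  replace (l_ n + h_ n) with (x + l_ n - x + (y + h_ n - y)) by ring.
  apply HB; try lra.
  - intros s t Hs Ht. apply cdiff_ccont, HF; lra.
  - intros s t Hs Ht. eapply Rle_trans; [apply Happ|].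
    + eapply Rle_lt_trans; [apply Hdist; auto|exact Hn].
    + apply Rmult_le_compat_l; [lra|]. apply Hdist; auto. }
assert (E4 : 4 ^ n = 2 ^ n * 2 ^ n) by (rewrite <- Rpow_mult_distr; f_equal; lra).
assert (HB3 : E <= 4 * eta * (D * D)).
{ apply Rmult_le_reg_r with (/ 4 ^ n); [apply Rinv_0_lt_compat, pow_lt; lra|].
  eapply Rle_trans; [exact HB2|]. right. rewrite E4. field. apply Rgt_not_eq, P2. }
assert (HE8 : E = 8 * eta * (D * D + 1)) by (unfold eta; field; nra).
nra.
Qed.

(** * Integrals over circles *)

Lemma two_PI_pos : 0 < 2 * PI.
Proof. generalize PI_RGT_0; lra. Qed.

Lemma ccont_uniform_v (F : C -> C) (s a b : R) : (forall t, a <= t <= b -> ccont F (s, t)) ->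
  forall eps, 0 < eps -> exists del, 0 < del /\
    forall s' t, Rabs (s' - s) < del -> a <= t <= b -> Cmod (F (s', t) - F (s, t)) < eps.
Proof.
intros HF e He.
(* The radius is [2 * d] because [(s', t)] will differ from [(s, u)] by less than [d] in each
   coordinate. *)
assert (H : forall t, exists d : posreal, a <= t <= b ->
  forall w, Cmod (w - (s, t)) < 2 * d -> Cmod (F w - F (s, t)) < e / 2).
{ intros t. destruct (excluded_middle_informative (a <= t <= b)) as [Ht|Ht].
  - destruct (HF t Ht (e / 2)) as [d [Hd H]]; [lra|].
    assert (Hd2 : 0 < d / 2) by lra. exists (mkposreal _ Hd2). intros _ w Hw.
    apply H. simpl in Hw. lra.
  - exists (mkposreal 1 Rlt_0_1). intros Ht'. contradiction. }
pose (del := fun t => proj1_sig (constructive_indefinite_description _ (H t))).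
assert (Hdel : forall t, a <= t <= b ->
  forall w, Cmod (w - (s, t)) < 2 * del t -> Cmod (F w - F (s, t)) < e / 2)
  by (intros t; exact (proj2_sig (constructive_indefinite_description _ (H t)))).
destruct (compactness_value_1d a b del) as [d Hd].
exists d; split; [apply cond_pos|]. intros s' t Hs Ht.
(* The compactness lemma yields its covering point only under a double negation. *)
apply NNPP. intros Hn. apply (Hd t Ht). intros [u [Hu [Htu Hdu]]]. apply Hn.
replace (F (s', t) - F (s, t))%C with ((F (s', t) - F (s, u)) - (F (s, t) - F (s, u)))%C by ring.
eapply Rle_lt_trans; [apply Cmod_minus_le|].
assert (Cmod (F (s', t) - F (s, u)) < e / 2).
{ apply Hdel; auto. eapply Rle_lt_trans; [apply Cmod_le_sum|]. simpl.
  unfold Rminus in *. lra. }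
assert (Cmod (F (s, t) - F (s, u)) < e / 2).
{ apply Hdel; auto. eapply Rle_lt_trans; [apply Cmod_le_sum|]. simpl.
  replace (s + - s) with 0 by ring. rewrite Rabs_R0. unfold Rminus in *.
  generalize (cond_pos d). lra. }
lra.
Qed.

Lemma CI_v_continuous (F : C -> C) (s a b : R) : a <= b -> s < 0 ->
  (forall w, Re w < 0 -> ccont F w) ->
  forall eps, 0 < eps -> exists del, 0 < del /\ forall s', s' < 0 -> Rabs (s' - s) < del ->
    Cmod (CI (fun t => F (s', t)) a b - CI (fun t => F (s, t)) a b) < eps.
Proof.
intros Hab Hs HF e He.
destruct (ccont_uniform_v F s a b (fun t _ => HF (s, t) Hs) (e / (2 * (b - a + 1)))) as [d [Hd H]].
{ apply Rdiv_lt_0_compat; lra. }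
exists d; split; auto. intros s' Hs' Hd'.
rewrite <- CI_minus by (auto; intros t Ht; apply ccont_pcont_v, HF; assumption).
eapply Rle_lt_trans.
- apply CI_bound with (M := e / (2 * (b - a + 1))); auto.
  + intros t Ht; apply pcont_minus; apply ccont_pcont_v, HF; assumption.
  + intros t Ht. left. apply H; auto.
- apply Rmult_lt_reg_r with (b - a + 1); [lra|].
  replace (2 * (e / (2 * (b - a + 1))) * (b - a) * (b - a + 1)) with (e * (b - a)) by (field; lra).
  nra.
Qed.

Lemma CI_v_constant (F : C -> C) (s0 p : R) : 0 <= p -> s0 < 0 ->
  (forall w, Re w < 0 -> ccont F w) ->
  (forall w, Re w < 0 -> Re w <> s0 -> cdiff F w) ->
  (forall s, F (s, p) = F (s, 0)) ->
  forall s, s < 0 -> CI (fun t => F (s, t)) 0 p = CI (fun t => F (s0, t)) 0 p.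
Proof.
intros Hp Hs0 Hc Hd Hper.
(* Goursat on a rectangle that misses the line [Re w = s0]; its horizontal sides cancel by
   [Hper]. *)
assert (L : forall s1 s2, s1 <= s2 -> s2 < 0 -> (s2 < s0 \/ s0 < s1) ->
  CI (fun t => F (s1, t)) 0 p = CI (fun t => F (s2, t)) 0 p).
{ intros s1 s2 H12 H2 Hor.
  assert (G := goursat F s1 (s2 - s1) 0 p).
  replace (s1 + (s2 - s1)) with s2 in G by ring. rewrite Rplus_0_l in G.
  unfold boundary_integral in G.
  rewrite (CI_ext s1 s2 H12 _ (fun _ => 0%C)) in G by (intros; rewrite Hper; ring).
  rewrite (CI_const), CI_minus in G by (auto; intros t Ht; apply ccont_pcont_v, Hc; simpl; lra).
  assert (G' := G ltac:(lra) Hp).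
  assert (E : (Ci * (CI (fun t => F (s2, t)) 0 p - CI (fun t => F (s1, t)) 0 p) - 0 * (s2 - s1)%R)%C = 0%C).
  { apply G'. intros s t Hs Ht. apply Hd; simpl; lra. }
  assert (E2 : (CI (fun t => F (s2, t)) 0 p - CI (fun t => F (s1, t)) 0 p)%C = 0%C).
  { apply Cmod_eq_0. rewrite <- (Rmult_1_l (Cmod _)), <- Cmod_Ci, <- Cmod_mult.
    rewrite <- Cmod_0 at 3. f_equal. rewrite <- E. ring. }
  replace (CI (fun t => F (s2, t)) 0 p) with
    ((CI (fun t => F (s2, t)) 0 p - CI (fun t => F (s1, t)) 0 p) + CI (fun t => F (s1, t)) 0 p)%C by ring.
  rewrite E2. ring. }
intros s Hs.
destruct (Req_dec s s0) as [->|Hne]; auto.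
cut (Cmod (CI (fun t => F (s, t)) 0 p - CI (fun t => F (s0, t)) 0 p) <= 0).
{ intros H. assert (E : (CI (fun t => F (s, t)) 0 p - CI (fun t => F (s0, t)) 0 p)%C = 0%C).
  { apply Cmod_eq_0. apply Rle_antisym; auto. apply Cmod_ge_0. }
  replace (CI (fun t => F (s, t)) 0 p) with
    ((CI (fun t => F (s, t)) 0 p - CI (fun t => F (s0, t)) 0 p) + CI (fun t => F (s0, t)) 0 p)%C by ring.
  rewrite E. ring. }
apply le_epsilon. intros e He. rewrite Rplus_0_l. left.
destruct (CI_v_continuous F s0 0 p Hp Hs0 Hc e He) as [d [Hdp H]].
destruct (Rdichotomy _ _ Hne) as [Hlt|Hgt].
(* [s'] lies on the same side of [s0] as [s], so the integral is unchanged, and within [d] of [s0],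
   so continuity applies. *)
- pose (s' := Rmax s (s0 - d / 2)).
  assert (H1 : s <= s') by apply Rmax_l. assert (H2 : s0 - d / 2 <= s') by apply Rmax_r.
  assert (H3 : s' < s0) by (apply Rmax_lub_lt; lra).
  rewrite (L s s'); auto; [|lra]. apply H; [lra|]. apply Rabs_lt_between. lra.
- pose (s' := Rmin s (s0 + d / 2)).
  assert (H1 : s' <= s) by apply Rmin_l. assert (H2 : s' <= s0 + d / 2) by apply Rmin_r.
  assert (H3 : s0 < s') by (apply Rmin_glb_lt; lra).
  rewrite <- (L s' s); auto. apply H; [lra|]. apply Rabs_lt_between. lra.
Qed.

(* Angular integral over the circle of radius [exp s]. *)
Definition circle_int (G : C -> C) (s : R) : C := CI (fun t => G (cexp (s, t))) 0 (2 * PI).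

Lemma Cmod_cexp_lt_1 (w : C) : Re w < 0 -> 0 < Cmod (cexp w) < 1.
Proof. intros H. rewrite Cmod_cexp. split; [apply exp_pos|]. rewrite <- exp_0. now apply exp_increasing. Qed.

Lemma circle_int_constant (G : C -> C) (s0 : R) : s0 < 0 ->
  (forall z, 0 < Cmod z < 1 -> ccont G z) ->
  (forall z, 0 < Cmod z < 1 -> Cmod z <> exp s0 -> cdiff G z) ->
  forall s, s < 0 -> circle_int G s = circle_int G s0.
Proof.
intros Hs0 Hc Hd s Hs.
apply (CI_v_constant (fun w => G (cexp w)) s0 (2 * PI)); auto.
- generalize two_PI_pos; lra.
- intros w Hw. apply (ccont_comp G cexp); [|apply cdiff_ccont, cdiff_cexp].
  apply Hc, Cmod_cexp_lt_1, Hw.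
- intros w Hw Hn. apply (cdiff_comp G cexp); [|apply cdiff_cexp].
  apply Hd; [apply Cmod_cexp_lt_1, Hw|]. rewrite Cmod_cexp. intros E. now apply Hn, exp_inv.
- intros r. f_equal. unfold cexp; simpl. now rewrite cos_2PI, sin_2PI, cos_0, sin_0.
Qed.

Lemma circle_pcont (G : C -> C) (s : R) : (forall z, Cmod z = exp s -> ccont G z) ->
  forall t, pcont (fun t => G (cexp (s, t))) t.
Proof.
intros HG t. apply (ccont_pcont_v (fun w => G (cexp w))).
apply (ccont_comp G cexp); [|apply cdiff_ccont, cdiff_cexp]. apply HG. apply Cmod_cexp.
Qed.

Lemma circle_int_minus (G H : C -> C) (s : R) :
  (forall z, Cmod z = exp s -> ccont G z) -> (forall z, Cmod z = exp s -> ccont H z) ->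
  circle_int (fun z => (G z - H z)%C) s = (circle_int G s - circle_int H s)%C.
Proof.
intros HG HH. apply CI_minus; [generalize two_PI_pos; lra| |]; intros t _; now apply circle_pcont.
Qed.

Lemma circle_int_scal (c : C) (G : C -> C) (s : R) :
  (forall z, Cmod z = exp s -> ccont G z) ->
  circle_int (fun z => (c * G z)%C) s = (c * circle_int G s)%C.
Proof.
intros HG. apply CI_scal; [generalize two_PI_pos; lra|]; intros t _; now apply circle_pcont.
Qed.

Lemma circle_int_ext (G H : C -> C) (s : R) : (forall z, Cmod z = exp s -> G z = H z) ->
  circle_int G s = circle_int H s.
Proof.
intros E. apply CI_ext; [generalize two_PI_pos; lra|]. intros t _. apply E, Cmod_cexp.
Qed.

Lemma circle_int_bound (G : C -> C) (s M : R) : (forall z, Cmod z = exp s -> ccont G z) ->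
  (forall z, Cmod z = exp s -> Cmod (G z) <= M) -> Cmod (circle_int G s) <= 2 * M * (2 * PI).
Proof.
intros HG HM. replace (2 * PI) with (2 * PI - 0) by ring.
apply CI_bound.
- generalize two_PI_pos; lra.
- intros t _. now apply circle_pcont.
- intros t _. apply HM, Cmod_cexp.
Qed.

Lemma polar_form (z : C) (s : R) : Cmod z = exp s -> exists t, 0 <= t <= 2 * PI /\ z = cexp (s, t).
Proof.
intros H. destruct z as [x y]. assert (He := exp_pos s).
assert (HP := PI_RGT_0).
assert (HM : Cmod (x, y) ^ 2 = x ^ 2 + y ^ 2) by apply Cmod2_alt.
rewrite H in HM.
assert (Hx := re_le_Cmod (x, y)). rewrite H in Hx. simpl in Hx. apply Rabs_le_between in Hx.
set (u := x / exp s).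
assert (Hu : -1 <= u <= 1).
{ unfold u. split; [apply Rle_div_r|apply Rle_div_l]; lra. }
assert (Ex : x = exp s * u) by (unfold u; field; lra).
assert (Hac := acos_bound u).
assert (Hs := sin_acos u Hu).
assert (Ey : Rabs y = exp s * sqrt (1 - u²)).
{ rewrite <- (sqrt_pow2 (exp s)) by lra. rewrite <- sqrt_mult.
  - rewrite <- sqrt_Rsqr_abs. f_equal. unfold Rsqr. rewrite Ex in HM.
    rewrite Ex in H. nra.
  - nra.
  - unfold Rsqr. nra. }
destruct (Rle_dec 0 y) as [Hy|Hy].
- exists (acos u). split; [lra|]. unfold cexp; simpl. rewrite cos_acos, Hs by lra.
  rewrite <- Ex, <- Ey, Rabs_pos_eq; auto.
- exists (2 * PI - acos u). split; [lra|]. unfold cexp; simpl.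
  rewrite cos_minus, sin_minus, cos_2PI, sin_2PI, cos_acos, Hs by lra.
  f_equal; [lra|]. rewrite Rabs_left in Ey by lra. lra.
Qed.

Lemma circle_bounded (G : C -> C) (s : R) : (forall z, Cmod z = exp s -> ccont G z) ->
  exists M, forall z, Cmod z = exp s -> Cmod (G z) <= M.
Proof.
intros HG.
assert (K : forall f : R -> R, (forall t, continuous f t) ->
  exists M, forall t, 0 <= t <= 2 * PI -> Rabs (f t) <= M).
{ intros f Hf. destruct (continuity_ab_maj (fun t => Rabs (f t)) 0 (2 * PI)) as [m [Hm _]].
  - generalize two_PI_pos; lra.
  - intros t _. apply continuity_pt_filterlim. apply (continuous_comp f Rabs); auto.
    apply continuous_Rabs.
  - now exists (Rabs (f m)). }
destruct (K _ (fun t => proj1 (circle_pcont G s HG t))) as [M1 H1].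
destruct (K _ (fun t => proj2 (circle_pcont G s HG t))) as [M2 H2].
exists (M1 + M2). intros z Hz. destruct (polar_form z s Hz) as [t [Ht ->]].
eapply Rle_trans; [apply Cmod_le_sum|]. apply Rplus_le_compat; auto.
Qed.

(** Homogeneity replaces a trigonometric computation. Passing from radius [exp (-1)] to [exp (-2)]
    multiplies the integral by [mu ^ k], yet it does not depend on the radius, and [mu ^ k] has
    modulus [exp 1 ^ k], which is not 1. *)
Lemma circle_int_neg_pow (k : nat) (s : R) : s < 0 -> (0 < k)%nat ->
  circle_int (fun z => ((/ z) ^ k)%C) s = 0%C.
Proof.
intros Hs Hk.
assert (Hd : forall z, 0 < Cmod z < 1 -> cdiff (fun z => ((/ z) ^ k)%C) z).
{ intros z Hz. apply (cdiff_pow (fun z => (/ z)%C)). apply (cdiff_inv (fun z => z)); [apply cdiff_id|].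
  apply Cmod_gt_0, Hz. }
assert (Hc := circle_int_constant (fun z => ((/ z) ^ k)%C) (-1) ltac:(lra)
  (fun z Hz => cdiff_ccont _ _ (Hd z Hz)) (fun z Hz _ => Hd z Hz)).
rewrite (Hc s Hs).
assert (E := Hc (-2) ltac:(lra)).
set (I := circle_int _ (-1)) in *.
pose (mu := (/ cexp (-1, 0))%C).
assert (E2 : circle_int (fun z => ((/ z) ^ k)%C) (-2) = (mu ^ k * I)%C).
{ unfold I. rewrite <- circle_int_scal.
  - apply CI_ext; [generalize two_PI_pos; lra|]. intros t _.
    replace ((-2, t) : C) with ((-1, 0) + (-1, t))%C
      by (unfold Cplus; simpl; f_equal; ring).
    rewrite cexp_plus. unfold mu. rewrite <- Cpow_mult_l. f_equal. field.
    split; apply cexp_neq_0.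
  - intros z Hz. apply cdiff_ccont, Hd. rewrite Hz.
    generalize (Cmod_cexp_lt_1 (-1, 0)). rewrite Cmod_cexp. simpl. intros K. apply K. lra. }
rewrite E in E2.
assert (E3 : ((mu ^ k - 1) * I)%C = 0%C).
{ replace ((mu ^ k - 1) * I)%C with (mu ^ k * I - I)%C by ring. rewrite <- E2. ring. }
apply Cmod_eq_0. apply (f_equal Cmod) in E3. rewrite Cmod_mult, Cmod_0 in E3.
apply Rmult_integral in E3. destruct E3 as [E3|]; auto. exfalso.
apply Cmod_eq_0 in E3.
assert (E4 : (mu ^ k)%C = 1%C).
{ replace (mu ^ k)%C with (mu ^ k - 1 + 1)%C by ring. rewrite E3. ring. }
apply (f_equal Cmod) in E4. rewrite Cmod_pow, Cmod_1 in E4.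
unfold mu in E4. rewrite Cmod_inv, Cmod_cexp in E4 by apply cexp_neq_0. simpl in E4.
rewrite <- exp_Ropp in E4. replace (- -1) with 1 in E4 by ring.
assert (H1 : 1 < exp 1) by (rewrite <- exp_0 at 1; apply exp_increasing; lra).
assert (H2 := Rlt_pow_R1 (exp 1) k H1 Hk). lra.
Qed.

Lemma circle_int_1 (s : R) : circle_int (fun _ => 1%C) s = RtoC (2 * PI).
Proof. unfold circle_int. rewrite CI_const. rewrite Rminus_0_r. ring. Qed.

(** * Power series and Taylor expansion *)

Definition csum (a : nat -> C) : C := (Series (fun n => Re (a n)), Series (fun n => Im (a n))).

Definition csummable (a : nat -> C) : Prop :=
  ex_series (fun n => Re (a n)) /\ ex_series (fun n => Im (a n)).

Lemma csum_minus (a b : nat -> C) : csummable a -> csummable b ->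
  csum (fun n => (a n - b n)%C) = (csum a - csum b)%C.
Proof.
intros [A1 A2] [B1 B2]. unfold csum, Cminus, Cplus, Copp; simpl.
f_equal.
- exact (Series_minus _ _ A1 B1).
- exact (Series_minus _ _ A2 B2).
Qed.

Lemma csum_scal (c : C) (a : nat -> C) : csummable a ->
  csum (fun n => (c * a n)%C) = (c * csum a)%C.
Proof.
intros [A1 A2]. unfold csum, Cmult; simpl. rewrite <- !Series_scal_l.
assert (S : forall k f, ex_series f -> ex_series (fun n => k * f n))
  by (intros k f Hf; exact (ex_series_scal_l k f Hf)).
f_equal.
- rewrite <- Series_minus by (apply S; assumption). reflexivity.
- rewrite <- Series_plus by (apply S; assumption). reflexivity.
Qed.

Lemma csum_ext (a b : nat -> C) : (forall n, a n = b n) -> csum a = csum b.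
Proof. intros H. unfold csum. f_equal; apply Series_ext; intros n; now rewrite H. Qed.

Lemma csum_geom (a : nat -> C) (M q : R) : 0 <= q < 1 ->
  (forall n, Cmod (a n) <= M * q ^ n) ->
  csummable a /\ Cmod (csum a) <= 2 * (M / (1 - q)).
Proof.
intros Hq Ha.
assert (G : ex_series (fun n => M * q ^ n)).
{ apply (ex_series_scal_l M (fun n => q ^ n)). apply ex_series_geom. apply Rabs_lt_between. lra. }
assert (K : forall u, (forall n, Rabs (u n) <= Cmod (a n)) ->
  ex_series u /\ Rabs (Series u) <= M / (1 - q)).
{ intros u Hu.
  assert (Ex : ex_series (fun n => Rabs (u n))).
  { apply (ex_series_le (V := R_CompleteNormedModule)) with (b := fun n => M * q ^ n); auto.
    intros n. change (Rabs (Rabs (u n)) <= M * q ^ n). rewrite Rabs_Rabsolu.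
    eapply Rle_trans; [apply Hu|apply Ha]. }
  split; [now apply ex_series_Rabs|].
  eapply Rle_trans; [now apply Series_Rabs|].
  replace (M / (1 - q)) with (Series (fun n => M * q ^ n)).
  - apply Series_le; auto. intros n. split; [apply Rabs_pos|].
    eapply Rle_trans; [apply Hu|apply Ha].
  - rewrite Series_scal_l, Series_geom; [reflexivity|]. apply Rabs_lt_between. lra. }
destruct (K (fun n => Re (a n))) as [R1 R2]; [intros n; apply re_le_Cmod|].
destruct (K (fun n => Im (a n))) as [I1 I2]; [intros n; apply Im_le_Cmod|].
split; [split; assumption|].
eapply Rle_trans; [apply Cmod_le_sum|]. simpl. lra.
Qed.

Fixpoint cpartial (a : nat -> C) (n : nat) : C :=
  match n with O => a O | S m => (cpartial a m + a n)%C end.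

Lemma csum_of_partial (a : nat -> C) (l : C) (K x : R) : 0 <= x < 1 ->
  (forall n, Cmod (l - cpartial a n) <= K * x ^ n) -> csum a = l.
Proof.
intros Hx H.
assert (G : forall (p : C -> R), (forall u v, p (u + v)%C = p u + p v) ->
  (forall u v, Rabs (p u - p v) <= Cmod (u - v)) ->
  Series (fun n => p (a n)) = p l).
{ intros p Hp Hpl. apply is_series_unique.
  assert (E : forall n, sum_n (fun n => p (a n)) n = p (cpartial a n)).
  { induction n as [|n IH]; simpl; [apply sum_O|]. now rewrite sum_Sn, IH, Hp. }
  apply (is_lim_seq_ext (fun n => p (cpartial a n)) (sum_n (fun n => p (a n))) (p l));
    [intros n; now rewrite E|].
  assert (L : is_lim_seq (fun n => K * x ^ n) 0).
  { replace (Finite 0) with (Rbar_mult K 0) by (simpl; f_equal; ring).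
    apply is_lim_seq_scal_l. apply is_lim_seq_geom. apply Rabs_lt_between. lra. }
  apply is_lim_seq_le_le with (u := fun n => p l - K * x ^ n) (w := fun n => p l + K * x ^ n).
  - intros n. assert (Hb := Rle_trans _ _ _ (Hpl l (cpartial a n)) (H n)).
    apply Rabs_le_between in Hb. lra.
  - replace (Finite (p l)) with (Finite (p l - 0)) by (f_equal; ring).
    apply is_lim_seq_minus'; auto. apply is_lim_seq_const.
  - replace (Finite (p l)) with (Finite (p l + 0)) by (f_equal; ring).
    apply is_lim_seq_plus'; auto. apply is_lim_seq_const. }
unfold csum. rewrite (G Re), (G Im).
- now destruct l.
- reflexivity.
- intros u v. exact (Im_le_Cmod (u - v)%C).
- reflexivity.
- intros u v. exact (re_le_Cmod (u - v)%C).
Qed.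

(* Equivalently, the radius of convergence is at least 1. *)
Definition subexponential (a : nat -> C) : Prop :=
  forall rho, 0 < rho < 1 -> exists M, forall n, Cmod (a n) * rho ^ n <= M.

(** Boundedness at the midpoint of [r] and 1 leaves the ratio of [r] to that midpoint as a geometric
    factor. *)
Lemma subexponential_geom (a : nat -> C) (r : R) : subexponential a -> 0 <= r < 1 ->
  exists M q, 0 <= M /\ 0 <= q < 1 /\ forall n, Cmod (a n) * r ^ n <= M * q ^ n.
Proof.
intros Ha Hr. destruct (Ha ((1 + r) / 2)) as [M HM]; [lra|].
exists M, (r / ((1 + r) / 2)). split; [|split].
- eapply Rle_trans; [|apply (HM O)]. simpl. generalize (Cmod_ge_0 (a O)). lra.
- split; [apply Rdiv_le_0_compat; lra|]. apply Rlt_div_l; lra.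
- intros n. replace (r ^ n) with (((1 + r) / 2) ^ n * (r / ((1 + r) / 2)) ^ n)
    by (rewrite <- Rpow_mult_distr; f_equal; field; lra).
  rewrite <- Rmult_assoc. apply Rmult_le_compat_r; auto.
  apply pow_le, Rdiv_le_0_compat; lra.
Qed.

Lemma power_series_summable (a : nat -> C) (z : C) : subexponential a -> Cmod z < 1 ->
  csummable (fun n => (a n * z ^ n)%C).
Proof.
intros Ha Hz. destruct (subexponential_geom a (Cmod z) Ha) as [M [q [HM [Hq H]]]].
{ split; auto. apply Cmod_ge_0. }
apply (csum_geom _ M q Hq). intros n. rewrite Cmod_mult, Cmod_pow. apply H.
Qed.

(* [dpow z n] is [n z^(n-1)]. *)
Fixpoint dpow (z : C) (n : nat) : C :=
  match n with O => 0%C | S m => (z * dpow z m + z ^ m)%C end.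

(** The bound is chosen to reproduce itself in the recursion: [r s^n / (s - r) + s^n = s^(n+1) / (s
    - r)]. The next lemma repeats this with one more factor [s - r]. *)
Lemma dpow_bound (z : C) (r s : R) (n : nat) : 0 <= r < s -> Cmod z <= r ->
  Cmod (dpow z n) <= s ^ n / (s - r).
Proof.
intros Hr Hz. induction n as [|n IH]; simpl.
- rewrite Cmod_0. apply Rdiv_le_0_compat; lra.
- eapply Rle_trans; [apply Cmod_triangle|]. rewrite Cmod_mult, Cmod_pow.
  assert (H1 : Cmod z * Cmod (dpow z n) <= r * (s ^ n / (s - r))).
  { apply Rmult_le_compat; auto; apply Cmod_ge_0. }
  assert (H2 : Cmod z ^ n <= s ^ n).
  { apply pow_incr. split; [apply Cmod_ge_0|lra]. }
  replace (s * s ^ n / (s - r)) with (r * (s ^ n / (s - r)) + s ^ n) by (field; lra). lra.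
Qed.

Lemma pow_taylor_bound (z w : C) (r s : R) (n : nat) : 0 <= r < s -> Cmod z <= r -> Cmod w <= r ->
  Cmod (w ^ n - z ^ n - (w - z) * dpow z n)%C <= s ^ n / ((s - r) * (s - r)) * (Cmod (w - z) * Cmod (w - z)).
Proof.
intros Hr Hz Hw. induction n as [|n IH]; simpl.
- replace (1 - 1 - (w - z) * 0)%C with (RtoC 0) by ring. rewrite Cmod_0.
  apply Rmult_le_pos; [apply Rdiv_le_0_compat; nra|]. apply (Rle_0_sqr (Cmod (w - z))).
- replace (w * w ^ n - z * z ^ n - (w - z) * (z * dpow z n + z ^ n))%C
    with (w * (w ^ n - z ^ n - (w - z) * dpow z n) + (w - z) * (w - z) * dpow z n)%C by ring.
  eapply Rle_trans; [apply Cmod_triangle|]. rewrite !Cmod_mult.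
  set (D := Cmod (w - z) * Cmod (w - z)) in *.
  assert (HD : 0 <= D) by apply (Rle_0_sqr (Cmod (w - z))).
  assert (H1 := Rmult_le_compat _ _ _ _ (Cmod_ge_0 w) (Cmod_ge_0 _) Hw IH).
  assert (H2 := Rmult_le_compat_l _ _ _ HD (dpow_bound z r s n Hr Hz)).
  eapply Rle_trans; [apply Rplus_le_compat; [exact H1|exact H2]|].
  right. field. lra.
Qed.

(** Term by term, the error of the linear approximation is quadratic in [w - z] with factor
    [s^n / (s - r)^2]. Summed against [a n] it is at most [K * D * D], so [D <= e / (K + 1)]
    suffices. *)
Lemma power_series_cdiff (a : nat -> C) (z : C) : subexponential a -> Cmod z < 1 ->
  cdiff (fun w => csum (fun n => (a n * w ^ n)%C)) z.
Proof.
intros Ha Hz. assert (Hz0 := Cmod_ge_0 z).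
set (r := (1 + Cmod z) / 2). set (s := (1 + r) / 2).
assert (Hr : Cmod z < r < 1) by (unfold r; lra).
assert (Hs : r < s < 1) by (unfold s; lra).
destruct (subexponential_geom a s Ha) as [M [q [HM [Hq H]]]]; [lra|].
assert (Hsr : 0 < s - r) by lra.
apply approx_cdiff with (csum (fun n => (a n * dpow z n)%C)).
intros e He.
set (K := 2 * (M / ((s - r) * (s - r)) / (1 - q))).
assert (HK : 0 <= K).
{ apply Rmult_le_pos; [lra|]. apply Rdiv_le_0_compat; [|lra]. apply Rdiv_le_0_compat; auto. nra. }
exists (Rmin (r - Cmod z) (e / (K + 1))). split.
{ apply Rmin_glb_lt; [lra|]. apply Rdiv_lt_0_compat; lra. }
intros w Hw.
assert (Hw1 := Rlt_le_trans _ _ _ Hw (Rmin_l _ _)).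
assert (Hw2 := Rlt_le_trans _ _ _ Hw (Rmin_r _ _)).
assert (Hwr : Cmod w <= r) by (generalize (Cmod_minus_triangle w z); lra).
assert (Hsum : csummable (fun n => (a n * dpow z n)%C)).
{ apply (csum_geom _ (M / (s - r)) q Hq). intros n. rewrite Cmod_mult.
  eapply Rle_trans; [apply Rmult_le_compat_l; [apply Cmod_ge_0|]; apply (dpow_bound z r s); lra|].
  replace (M / (s - r) * q ^ n) with (M * q ^ n * / (s - r)) by (field; lra).
  unfold Rdiv. rewrite <- Rmult_assoc. apply Rmult_le_compat_r; auto.
  left; now apply Rinv_0_lt_compat. }
assert (Hsw := power_series_summable a w Ha ltac:(lra)).
assert (Hsz := power_series_summable a z Ha Hz).
rewrite <- csum_scal, <- csum_minus by assumption.
set (D := Cmod (w - z)) in *.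
assert (HD : 0 <= D) by apply Cmod_ge_0.
destruct (csum_geom (fun n => (a n * (w ^ n - z ^ n - (w - z) * dpow z n))%C)
  (M / ((s - r) * (s - r)) * (D * D)) q Hq) as [Hsd Hb].
{ intros n. rewrite Cmod_mult.
  eapply Rle_trans; [apply Rmult_le_compat_l; [apply Cmod_ge_0|];
    apply (pow_taylor_bound z w r s); lra|]. fold D.
  replace (M / ((s - r) * (s - r)) * (D * D) * q ^ n) with
    (M * q ^ n * (/ ((s - r) * (s - r)) * (D * D))) by (field; lra).
  replace (Cmod (a n) * (s ^ n / ((s - r) * (s - r)) * (D * D))) with
    (Cmod (a n) * s ^ n * (/ ((s - r) * (s - r)) * (D * D))) by (field; lra).
  apply Rmult_le_compat_r; auto. apply Rmult_le_pos; [|nra].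
  left; apply Rinv_0_lt_compat; nra. }
assert (Hdiff : csummable (fun n => (a n * w ^ n - a n * z ^ n)%C)).
{ destruct Hsw as [W1 W2], Hsz as [Z1 Z2]. split.
  - exact (ex_series_minus _ _ W1 Z1).
  - exact (ex_series_minus _ _ W2 Z2). }
(* This series is the difference of two series already known to converge. *)
assert (Hsc : csummable (fun n => ((w - z) * (a n * dpow z n))%C)).
{ destruct Hdiff as [F1 F2], Hsd as [S1 S2]. split.
  - apply (ex_series_ext (fun n => Re (a n * w ^ n - a n * z ^ n)%C -
      Re (a n * (w ^ n - z ^ n - (w - z) * dpow z n))%C)).
    + intros n. change (Re (a n * w ^ n - a n * z ^ n - (a n * (w ^ n - z ^ n - (w - z) * dpow z n)))%C =
        Re ((w - z) * (a n * dpow z n))%C). f_equal. ring.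
    + exact (ex_series_minus _ _ F1 S1).
  - apply (ex_series_ext (fun n => Im (a n * w ^ n - a n * z ^ n)%C -
      Im (a n * (w ^ n - z ^ n - (w - z) * dpow z n))%C)).
    + intros n. change (Im (a n * w ^ n - a n * z ^ n - (a n * (w ^ n - z ^ n - (w - z) * dpow z n)))%C =
        Im ((w - z) * (a n * dpow z n))%C). f_equal. ring.
    + exact (ex_series_minus _ _ F2 S2). }
rewrite <- csum_minus by assumption.
rewrite (csum_ext _ (fun n => (a n * (w ^ n - z ^ n - (w - z) * dpow z n))%C)) by (intros n; ring).
eapply Rle_trans; [exact Hb|].
replace (2 * (M / ((s - r) * (s - r)) * (D * D) / (1 - q))) with (K * D * D) by (unfold K; field; lra).
apply Rmult_le_compat_r; auto.
apply Rle_trans with (K * (e / (K + 1))); [apply Rmult_le_compat_l; lra|].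
apply Rle_trans with ((K + 1) * (e / (K + 1))); [|right; field; lra].
apply Rmult_le_compat_r; [|lra]. apply Rdiv_le_0_compat; lra.
Qed.

Lemma RtoC_pow_C (x : R) (n : nat) : (RtoC x ^ n)%C = RtoC (x ^ n).
Proof. induction n as [|n IH]; simpl; [reflexivity|]. now rewrite IH, RtoC_mult. Qed.

(** For real [z] the two coordinates are real power series with coefficients [Re (c n)] and
    [Im (c n)], to which real uniqueness applies. *)
Lemma power_series_eq_0 (c : nat -> C) : subexponential c ->
  (forall z, Cmod z < 1 -> csum (fun n => (c n * z ^ n)%C) = 0%C) -> forall n, c n = 0%C.
Proof.
intros Hc H.
assert (G : forall p : nat -> R, (forall n, Rabs (p n) <= Cmod (c n)) ->
  (forall x : R, Rabs x < 1 -> PSeries p x = 0) -> forall n, p n = 0).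
{ intros p Hp Hz n.
  assert (R1 : Rbar_lt 0 (CV_radius p)).
  { apply Rbar_lt_le_trans with (1 / 2); [simpl; lra|].
    apply CV_radius_bounded. destruct (Hc (1 / 2)) as [M HM]; [lra|]. exists M. intros m.
    rewrite Rabs_mult, (Rabs_pos_eq (_ ^ _)) by (apply pow_le; lra).
    eapply Rle_trans; [|apply (HM m)]. apply Rmult_le_compat_r; auto. apply pow_le; lra. }
  apply (PSeries_ext_recip p (fun _ => 0) n); auto.
  - apply Rbar_lt_le_trans with (1 / 2); [simpl; lra|].
    apply CV_radius_bounded. exists 0. intros m. rewrite Rmult_0_l, Rabs_R0. lra.
  - exists (mkposreal 1 Rlt_0_1). intros x Hx. rewrite Hz, PSeries_const_0; auto.
    change (Rabs (x - 0) < 1) in Hx. now rewrite Rminus_0_r in Hx. }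
assert (Hx : forall x : R, Rabs x < 1 ->
  PSeries (fun n => Re (c n)) x = 0 /\ PSeries (fun n => Im (c n)) x = 0).
{ intros x Hx. specialize (H x). rewrite Cmod_R in H. specialize (H Hx).
  unfold csum in H. apply pair_equal_spec in H. destruct H as [H1 H2].
  unfold PSeries.
  split; [rewrite <- H1|rewrite <- H2]; apply Series_ext; intros n; rewrite RtoC_pow_C;
    destruct (c n); simpl; ring. }
intros n. assert (E1 : Re (c n) = 0).
{ apply (G (fun n => Re (c n))); [intros; apply re_le_Cmod|]. intros x Hx'. now apply Hx. }
assert (E2 : Im (c n) = 0).
{ apply (G (fun n => Im (c n))); [intros; apply Im_le_Cmod|]. intros x Hx'. now apply Hx. }
destruct (c n) as [u v]. simpl in *. now subst.
Qed.

Lemma cdiff_ext_loc (f g : C -> C) (z : C) (d : R) : 0 < d ->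
  (forall w, Cmod (w - z) < d -> f w = g w) -> cdiff f z -> cdiff g z.
Proof.
intros Hd H [q [Hq [d' [Hd' H']]]]. exists q. split; auto.
exists (Rmin d d'); split; [apply Rmin_glb_lt; auto|]. intros w Hw.
rewrite <- H, <- H, H'; auto.
- eapply Rlt_le_trans; [exact Hw|apply Rmin_r].
- rewrite Cmod_self_minus. exact Hd.
- eapply Rlt_le_trans; [exact Hw|apply Rmin_l].
Qed.

Section Taylor.
Variables (f : C -> C) (Hf : forall z, Cmod z < 1 -> cdiff f z).

(** Near [z0] the function [Q] coincides with the Caratheodory quotient [q], of which only
    continuity at [z0] is known. *)
Lemma difference_quotient (z0 : C) : Cmod z0 < 1 -> exists Q : C -> C,
  (forall z, Cmod z < 1 -> ccont Q z) /\
  (forall z, Cmod z < 1 -> z <> z0 -> cdiff Q z) /\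
  (forall z, (f z - f z0)%C = (Q z * (z - z0))%C).
Proof.
intros Hz0. destruct (Hf z0 Hz0) as [q [Hq [d [Hd H]]]].
assert (Hne : forall w, w <> z0 -> (w - z0)%C <> 0%C).
{ intros w Hw E. apply Hw. replace w with ((w - z0) + z0)%C by ring. rewrite E. ring. }
pose (Q := fun z => if excluded_middle_informative (z = z0) then q z0
  else ((f z - f z0) * / (z - z0))%C).
assert (HQ : forall z, Cmod z < 1 -> z <> z0 -> cdiff Q z).
{ intros z Hz Hn. assert (Hn' := Hne z Hn).
  apply cdiff_ext_loc with (f := fun w => ((f w + - f z0) * / (w + - z0))%C) (d := Cmod (z - z0)).
  - now apply Cmod_gt_0.
  - intros w Hw. unfold Q. destruct (excluded_middle_informative (w = z0)) as [->|_]; auto.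
    rewrite Cmod_minus_rev in Hw. lra.
  - apply cdiff_mult.
    + apply cdiff_plus; [auto|apply cdiff_const].
    + apply (cdiff_inv (fun w => (w + - z0)%C)); auto.
      apply cdiff_plus; [apply cdiff_id|apply cdiff_const]. }
exists Q. split; [|split]; auto.
- intros z Hz. destruct (excluded_middle_informative (z = z0)) as [->|Hn].
  + apply ccont_ext_loc with (f := q) (d := d); auto. intros w Hw. unfold Q.
    destruct (excluded_middle_informative (w = z0)) as [->|Hn]; auto.
    rewrite (H w Hw). field. auto.
  + apply cdiff_ccont; auto.
- intros z. unfold Q. destruct (excluded_middle_informative (z = z0)) as [->|Hn]; [ring|].
  field. auto.
Qed.

Lemma exp_neg_lt_1 (s : R) : s < 0 -> 0 < exp s < 1.
Proof. intros H. split; [apply exp_pos|]. rewrite <- exp_0. now apply exp_increasing. Qed.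

Lemma circle_int_vanish (Q : C -> C) (z0 : C) : Cmod z0 < 1 ->
  (forall z, Cmod z < 1 -> ccont Q z) ->
  (forall z, Cmod z < 1 -> z <> z0 -> cdiff Q z) ->
  forall s, s < 0 -> circle_int (fun z => (Q z * z)%C) s = 0%C.
Proof.
intros Hz0 Hc Hd.
assert (H0 : exists s0, s0 < 0 /\ forall z, 0 < Cmod z -> Cmod z <> exp s0 -> z <> z0).
{ destruct (excluded_middle_informative (z0 = 0%C)) as [->|Hn].
  (* The origin lies on no circle, so any value serves as [s0]. *)
  - exists (-1). split; [lra|]. intros z Hz _. now apply Cmod_gt_0.
  - apply Cmod_gt_0 in Hn. exists (ln (Cmod z0)). rewrite exp_ln by auto. split.
    + rewrite <- ln_1. now apply ln_increasing.
    + intros z _ Hz ->. now apply Hz. }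
destruct H0 as [s0 [Hs0 Hz]].
assert (Hcc : forall z, Cmod z < 1 -> ccont (fun z => (Q z * z)%C) z).
{ intros z H. apply ccont_mult; auto. apply ccont_id. }
assert (HI : forall s, s < 0 -> circle_int (fun z => (Q z * z)%C) s = circle_int (fun z => (Q z * z)%C) s0).
{ apply circle_int_constant; auto.
  - intros z Hz'. apply Hcc; lra.
  - intros z Hz' Hn. apply cdiff_mult; [apply Hd; [lra|]|apply cdiff_id]. apply Hz; lra. }
intros s Hs. rewrite HI by auto. apply Cmod_eq_0. apply Rle_antisym; [|apply Cmod_ge_0].
apply le_epsilon. intros e He. rewrite Rplus_0_l.
assert (HP := PI_RGT_0).
destruct (Hcc 0%C ltac:(rewrite Cmod_0; lra) (e / (4 * PI))) as [d [Hdp H]].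
{ apply Rdiv_lt_0_compat; lra. }
(* On this circle the integrand is below [e / (4 * PI)], which [circle_int_bound] turns into exactly
   [e]. *)
pose (r := Rmin (1 / 2) (d / 2)).
assert (Hr : 0 < r) by (apply Rmin_glb_lt; lra).
assert (Hr1 : r <= 1 / 2) by apply Rmin_l. assert (Hr2 : r <= d / 2) by apply Rmin_r.
rewrite <- (HI (ln r)) by (rewrite <- ln_1; apply ln_increasing; lra).
eapply Rle_trans.
- apply (circle_int_bound _ _ (e / (4 * PI))); rewrite exp_ln by exact Hr; intros z Hz'.
  + apply Hcc; lra.
  + left. replace (Q z * z)%C with (Q z * z - Q 0 * 0)%C by ring. apply H.
    replace (z - 0)%C with z by ring. lra.
- right. field. lra.
Qed.

(** Cauchy's formula in the angle, where [dz / (2 i pi z^(n+1))] is [z^(-n) dt / (2 pi)]. The radius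
    [exp (-1)] is arbitrary. *)
Definition taylor_coef (n : nat) : C :=
  (/ (2 * PI)%R * circle_int (fun z => f z * (/ z) ^ n) (-1))%C.

Lemma cdiff_neg_pow (n : nat) (z : C) : 0 < Cmod z -> cdiff (fun z => ((/ z) ^ n)%C) z.
Proof.
intros Hz. apply (cdiff_pow (fun z => (/ z)%C)). apply (cdiff_inv (fun z => z)); [apply cdiff_id|].
now apply Cmod_gt_0.
Qed.

Lemma two_PI_C_neq_0 : RtoC (2 * PI) <> 0%C.
Proof. intros E. apply (f_equal Re) in E. simpl in E. generalize two_PI_pos; lra. Qed.

Lemma taylor_coef_circle (n : nat) (s : R) : s < 0 ->
  circle_int (fun z => f z * (/ z) ^ n)%C s = ((2 * PI)%R * taylor_coef n)%C.
Proof.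
intros Hs. unfold taylor_coef.
assert (Hd : forall z, 0 < Cmod z < 1 -> cdiff (fun z => f z * (/ z) ^ n)%C z).
{ intros z Hz. apply cdiff_mult; [apply Hf; lra|apply cdiff_neg_pow; lra]. }
rewrite (circle_int_constant _ (-1)) with (s := s); try lra.
- field. apply two_PI_C_neq_0.
- intros z Hz. apply cdiff_ccont, Hd, Hz.
- auto.
Qed.

(** Cauchy's estimate, on the circle of radius [r] itself. *)
Lemma taylor_coef_subexponential : subexponential taylor_coef.
Proof.
intros r Hr.
assert (Hs : ln r < 0) by (rewrite <- ln_1; apply ln_increasing; lra).
assert (Er : exp (ln r) = r) by (apply exp_ln; lra).
destruct (circle_bounded f (ln r)) as [M HM].
{ intros z Hz. apply cdiff_ccont, Hf. lra. }
exists (2 * M). intros n.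
assert (Hp : 0 < r ^ n) by (apply pow_lt; lra).
assert (HP := two_PI_pos).
assert (B : Cmod (circle_int (fun z => f z * (/ z) ^ n)%C (ln r)) <= 2 * (M * / r ^ n) * (2 * PI)).
{ apply circle_int_bound; intros z Hz.
  - apply cdiff_ccont, cdiff_mult; [apply Hf; lra|apply cdiff_neg_pow; lra].
  - rewrite Cmod_mult, Cmod_pow, Cmod_inv by (apply Cmod_gt_0; lra).
    rewrite Hz, Er, pow_inv. apply Rmult_le_compat_r; auto.
    left; now apply Rinv_0_lt_compat. }
rewrite taylor_coef_circle, Cmod_mult, Cmod_R, Rabs_pos_eq in B by lra.
apply Rmult_le_reg_l with (2 * PI * / r ^ n).
{ apply Rmult_lt_0_compat; auto. now apply Rinv_0_lt_compat. }
replace (2 * PI * / r ^ n * (Cmod (taylor_coef n) * r ^ n)) with (2 * PI * Cmod (taylor_coef n))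
  by (field; lra).
replace (2 * PI * / r ^ n * (2 * M)) with (2 * (M * / r ^ n) * (2 * PI)) by (field; lra).
exact B.
Qed.

(* With [x = z0 / z], the identity [Q z z = (f z - f z0) (1 + ... + x^n) + Q z z x^(n+1)]
   integrated over a circle. *)
Lemma taylor_remainder (Q : C -> C) (z0 : C) (s : R) (n : nat) : s < 0 ->
  (forall z, Cmod z < 1 -> ccont Q z) ->
  (forall z, (f z - f z0)%C = (Q z * (z - z0))%C) ->
  circle_int (fun z => (Q z * z)%C) s = 0%C ->
  circle_int (fun z => (Q z * z * (z0 * / z) ^ S n)%C) s =
  ((2 * PI)%R * (f z0 - cpartial (fun k => taylor_coef k * z0 ^ k)%C n))%C.
Proof.
intros Hs HQ HE H0.
assert (Hes := exp_neg_lt_1 s Hs).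
assert (Cx : forall k z, Cmod z = exp s -> ccont (fun z => ((z0 * / z) ^ k)%C) z).
{ intros k z Hz. apply cdiff_ccont. apply (cdiff_pow (fun z => (z0 * / z)%C)).
  apply cdiff_mult; [apply cdiff_const|]. apply (cdiff_inv (fun z => z)); [apply cdiff_id|].
  apply Cmod_gt_0. lra. }
assert (CQ : forall k z, Cmod z = exp s -> ccont (fun z => (Q z * z * (z0 * / z) ^ k)%C) z).
{ intros k z Hz. apply ccont_mult; auto. apply ccont_mult; [apply HQ; lra|apply ccont_id]. }
assert (Step : forall k, circle_int (fun z => (Q z * z * (z0 * / z) ^ S k)%C) s =
  (circle_int (fun z => (Q z * z * (z0 * / z) ^ k)%C) s - z0 ^ k *
    ((2 * PI)%R * taylor_coef k - f z0 * circle_int (fun z => ((/ z) ^ k)%C) s))%C).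
{ intros k. rewrite <- taylor_coef_circle with (s := s) by auto.
  assert (C1 : forall z, Cmod z = exp s -> ccont (fun z => ((/ z) ^ k)%C) z).
  { intros z Hz. apply cdiff_ccont, cdiff_neg_pow. lra. }
  assert (C2 : forall z, Cmod z = exp s -> ccont (fun z => (f z * (/ z) ^ k)%C) z).
  { intros z Hz. apply ccont_mult; auto. apply cdiff_ccont, Hf. lra. }
  rewrite <- circle_int_scal by auto.
  rewrite <- circle_int_minus by (auto; intros z Hz; apply ccont_mult; auto; apply ccont_const).
  rewrite <- circle_int_scal.
  - rewrite <- circle_int_minus; auto.
    + apply circle_int_ext. intros z Hz.
      assert (Hzn : z <> 0%C) by (apply Cmod_gt_0; lra).
      replace (z0 ^ k * (f z * (/ z) ^ k - f z0 * (/ z) ^ k))%C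
        with ((f z - f z0) * (z0 * / z) ^ k)%C by (rewrite Cpow_mult_l; ring).
      rewrite HE. simpl. field. exact Hzn.
    + intros z Hz. apply ccont_ext_loc with (f := fun z => ((f z + - f z0) * (z0 * / z) ^ k)%C) (d := 1).
      * lra.
      * intros w _. rewrite Cpow_mult_l. ring.
      * apply ccont_mult; auto. apply ccont_plus; [|apply ccont_const]. apply cdiff_ccont, Hf. lra.
  - intros z Hz. apply ccont_ext_loc with (f := fun z => ((f z + - f z0) * (/ z) ^ k)%C) (d := 1).
    + lra.
    + intros w _. ring.
    + apply ccont_mult; auto. apply ccont_plus; [|apply ccont_const]. apply cdiff_ccont, Hf. lra. }
(* The term in [f z0] survives only for [k = 0], where the integral of [(/ z) ^ k] is [2 * PI]; for
   [k > 0] it vanishes. *)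
induction n as [|n IH]; rewrite Step.
- simpl.
  rewrite (circle_int_ext _ (fun z => (Q z * z)%C)) by (intros; ring). rewrite H0, circle_int_1. ring.
- rewrite IH, circle_int_neg_pow by (auto; lia). simpl. ring.
Qed.

(** On a circle of radius [r] between [Cmod z] and 1, the ratio [z / w] has modulus
    [Cmod z / r < 1], so the remainder decays geometrically. *)
Lemma taylor_expansion (z : C) : Cmod z < 1 -> f z = csum (fun n => (taylor_coef n * z ^ n)%C).
Proof.
intros Hz. symmetry.
destruct (difference_quotient z Hz) as [Q [HQ [HQ2 HE]]].
assert (Hz0 := Cmod_ge_0 z).
set (r := (1 + Cmod z) / 2).
assert (Hr : Cmod z < r < 1) by (unfold r; lra).
assert (Hs : ln r < 0) by (rewrite <- ln_1; apply ln_increasing; lra).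
assert (Er : exp (ln r) = r) by (apply exp_ln; lra).
destruct (circle_bounded (fun w => (Q w * w)%C) (ln r)) as [M HM].
{ intros w Hw. apply ccont_mult; [apply HQ; lra|apply ccont_id]. }
assert (Hq : 0 <= Cmod z / r < 1).
{ split; [apply Rdiv_le_0_compat; lra|]. apply Rlt_div_l; lra. }
assert (HP := two_PI_pos).
apply (csum_of_partial _ _ (2 * M * (Cmod z / r)) (Cmod z / r) Hq). intros n.
assert (E := taylor_remainder Q z (ln r) n Hs HQ HE (circle_int_vanish Q z Hz HQ HQ2 _ Hs)).
apply Rmult_le_reg_l with (2 * PI); auto.
rewrite <- (Rabs_pos_eq (2 * PI)), <- Cmod_R at 1 by lra. rewrite <- Cmod_mult, <- E.
eapply Rle_trans; [apply (circle_int_bound _ _ (M * (Cmod z / r) ^ S n)); intros w Hw|].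
- apply ccont_mult; [apply ccont_mult; [apply HQ; lra|apply ccont_id]|].
  apply cdiff_ccont, (cdiff_pow (fun w => (z * / w)%C)).
  apply cdiff_mult; [apply cdiff_const|]. apply (cdiff_inv (fun w => w)); [apply cdiff_id|].
  apply Cmod_gt_0. lra.
- rewrite Cmod_mult, Cmod_pow, (Cmod_mult z), Cmod_inv by (apply Cmod_gt_0; lra).
  rewrite Hw, Er. apply Rmult_le_compat_r; auto.
  apply pow_le, Hq.
- right. simpl. ring.
Qed.

End Taylor.

(** * The spectrum of a rotation *)

Lemma eventually_bounded (u : nat -> R) (M : R) (N : nat) :
  (forall n, (N <= n)%nat -> u n <= M) -> exists M', forall n, u n <= M'.
Proof.
induction N as [|N IH]; intros H.
- exists M. intros n. apply H. lia.
- revert H. generalize (Rmax_l M (u N)) (Rmax_r M (u N)). set (M1 := Rmax M (u N)).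
  intros H1 H2 H. clear IH. clearbody M1.
  assert (G : forall k, exists M', forall n, (n <= k)%nat -> u n <= M').
  { induction k as [|k [M' HM]].
    - exists (u 0%nat). intros n Hn. replace n with 0%nat by lia. lra.
    - exists (Rmax M' (u (S k))). intros n Hn. destruct (Nat.eq_dec n (S k)) as [->|Hne].
      + apply Rmax_r.
      + eapply Rle_trans; [apply HM; lia|apply Rmax_l]. }
  destruct (G N) as [M' HM]. exists (Rmax M M'). intros n.
  destruct (Nat.le_gt_cases n N).
  + eapply Rle_trans; [apply HM; auto|apply Rmax_r].
  + eapply Rle_trans; [apply H; lia|apply Rmax_l].
Qed.

(** Split [r] as [sqrt r * sqrt r]: one factor controls [a n], the other compensates the small
    divisor [d n]. *)
Lemma subexponential_div (a d : nat -> C) : subexponential a -> (forall n, d n <> 0%C) ->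
  (forall rho, 0 < rho < 1 -> exists N, forall n, (N <= n)%nat -> rho ^ n <= Cmod (d n)) ->
  subexponential (fun n => (a n / d n)%C).
Proof.
intros Ha Hd0 Hd r Hr.
assert (Hs : 0 < sqrt r < 1).
{ split; [apply sqrt_lt_R0; lra|]. rewrite <- sqrt_1. apply sqrt_lt_1; lra. }
assert (Er : r = sqrt r * sqrt r) by (symmetry; apply sqrt_sqrt; lra).
destruct (Ha _ Hs) as [M HM]. destruct (Hd _ Hs) as [N HN].
apply (eventually_bounded _ M N). intros n Hn.
assert (Hp : 0 < Cmod (d n)) by (apply Cmod_gt_0; auto).
rewrite Cmod_div by auto. rewrite Er, Rpow_mult_distr.
apply Rle_trans with (Cmod (a n) * sqrt r ^ n); auto.
replace (Cmod (a n) / Cmod (d n) * (sqrt r ^ n * sqrt r ^ n)) with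
  (Cmod (a n) * sqrt r ^ n * (sqrt r ^ n / Cmod (d n))) by (field; lra).
rewrite <- (Rmult_1_r (Cmod (a n) * sqrt r ^ n)) at 2.
apply Rmult_le_compat_l.
- apply Rmult_le_pos; [apply Cmod_ge_0|apply pow_le; lra].
- apply Rle_div_l; [exact Hp|]. rewrite Rmult_1_l. auto.
Qed.

Section Rotation.
Variables (beta lam : C) (Hbeta : Cmod beta = 1).

Lemma Cmod_rotation (z : C) : Cmod (beta * z) = Cmod z.
Proof. rewrite Cmod_mult, Hbeta. ring. Qed.

Lemma Cmod_rotation_pow (n : nat) : Cmod (beta ^ n) = 1.
Proof. rewrite Cmod_pow, Hbeta. apply pow1. Qed.

Lemma rotation_series (a : nat -> C) (z : C) : subexponential a -> Cmod z < 1 ->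
  (lam * csum (fun n => a n * z ^ n) - csum (fun n => a n * (beta * z) ^ n))%C =
  csum (fun n => ((lam - beta ^ n) * a n * z ^ n)%C).
Proof.
intros Ha Hz.
assert (H1 := power_series_summable a z Ha Hz).
assert (H2 := power_series_summable a (beta * z) Ha ltac:(rewrite Cmod_rotation; exact Hz)).
rewrite <- csum_scal by auto.
assert (H3 : csummable (fun n => (lam * (a n * z ^ n))%C)).
{ apply (power_series_summable (fun n => (lam * a n)%C) z) in Hz.
  - destruct Hz as [K1 K2]. split; [revert K1|revert K2]; apply ex_series_ext; intros n; f_equal; ring.
  - intros r Hr. destruct (Ha r Hr) as [M HM]. exists (Cmod lam * M). intros n.
    rewrite Cmod_mult, Rmult_assoc. apply Rmult_le_compat_l; [apply Cmod_ge_0|auto]. }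
rewrite <- csum_minus by auto. apply csum_ext. intros n. rewrite Cpow_mult_l. ring.
Qed.

Lemma rotation_bijective : (forall n, lam <> (beta ^ n)%C) ->
  (forall rho, 0 < rho < 1 -> exists N, forall n, (N <= n)%nat -> rho ^ n <= Cmod (lam - beta ^ n)) ->
  bijective_on_Hol beta lam.
Proof.
intros Hne Hgrow.
assert (Hd0 : forall n, (lam - beta ^ n)%C <> 0%C).
{ intros n E. apply (Hne n). replace lam with ((lam - beta ^ n) + beta ^ n)%C by ring.
  rewrite E. ring. }
assert (T : forall f, Hol f -> forall z, Cmod z < 1 -> cdiff f z)
  by (intros f Hf z Hz; apply ex_derive_cdiff, Hf, Hz).
split.
- intros f1 f2 H1 H2 H z Hz.
  generalize (T f1 H1) (T f2 H2). clear H1 H2. intros H1 H2.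
  set (a := taylor_coef f1). set (b := taylor_coef f2).
  assert (Ha : subexponential a) by (apply taylor_coef_subexponential; auto).
  assert (Hb : subexponential b) by (apply taylor_coef_subexponential; auto).
  assert (Hab : forall n, ((lam - beta ^ n) * (a n - b n))%C = 0%C).
  (* The multipliers are bounded by [Cmod lam + 1]. *)
  { assert (S : forall c, subexponential c -> subexponential (fun n => ((lam - beta ^ n) * c n)%C)).
    { intros c Hc r Hr. destruct (Hc r Hr) as [M HM]. exists ((Cmod lam + 1) * M). intros n.
      rewrite Cmod_mult, Rmult_assoc. apply Rmult_le_compat; auto; try apply Cmod_ge_0.
      - apply Rmult_le_pos; [apply Cmod_ge_0|apply pow_le; lra].
      - rewrite <- (Cmod_rotation_pow n). apply Cmod_minus_le. }
    assert (Sm : subexponential (fun n => ((lam - beta ^ n) * (a n - b n))%C)).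
    { apply S. intros r Hr. destruct (Ha r Hr) as [M HM], (Hb r Hr) as [M' HM'].
      exists (M + M'). intros n.
      eapply Rle_trans; [apply Rmult_le_compat_r; [apply pow_le; lra|apply Cmod_minus_le]|].
      generalize (HM n) (HM' n). lra. }
    apply (power_series_eq_0 _ Sm). intros w Hw.
    rewrite (csum_ext _ (fun n => ((lam - beta ^ n) * a n * w ^ n - (lam - beta ^ n) * b n * w ^ n)%C))
      by (intros n; ring).
    assert (Sa := power_series_summable _ w (S a Ha) Hw).
    assert (Sb := power_series_summable _ w (S b Hb) Hw).
    rewrite csum_minus by assumption.
    rewrite <- !rotation_series by assumption.
    assert (Hbw : Cmod (beta * w) < 1) by (now rewrite Cmod_rotation).
    unfold a, b. rewrite <- !taylor_expansion by assumption.
    specialize (H w Hw). unfold Comp in H. rewrite H. ring. }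
  rewrite (taylor_expansion f1 H1 z Hz), (taylor_expansion f2 H2 z Hz).
  apply csum_ext. intros n. f_equal. fold a b.
  replace (a n) with (/ (lam - beta ^ n) * ((lam - beta ^ n) * (a n - b n)) + b n)%C
    by (field; auto).
  rewrite Hab. ring.
- intros h Hh0. assert (Hh := T h Hh0).
  assert (Hc := taylor_coef_subexponential h Hh).
  set (c := taylor_coef h) in *.
  assert (Hq := subexponential_div c _ Hc Hd0 Hgrow).
  exists (fun z => csum (fun n => (c n / (lam - beta ^ n) * z ^ n)%C)). split.
  + intros z Hz. apply ex_derive_cdiff. now apply (power_series_cdiff (fun n => c n / (lam - beta ^ n))%C).
  + intros z Hz. unfold Comp.
    rewrite (rotation_series (fun n => c n / (lam - beta ^ n))%C) by auto.
    rewrite (taylor_expansion h Hh z Hz). fold c. apply csum_ext. intros n. field. auto.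
Qed.

(** Injectivity fails: [z^n] and 0 have the same image and differ at [1/2]. *)
Lemma rotation_eigenvalue (n : nat) : spectrum beta (beta ^ n)%C.
Proof.
intros [H _].
assert (E : ((1 / 2)%R : C) <> 0%C).
{ intros E. apply (f_equal Re) in E. simpl in E. lra. }
apply (Cpow_nz _ n E).
apply (H (fun w => (w ^ n)%C) (fun _ => 0%C)).
- intros w _. apply ex_derive_cdiff, (cdiff_pow (fun w => w)), cdiff_id.
- intros w _. apply ex_derive_cdiff, cdiff_const.
- intros z _. unfold Comp. rewrite Cpow_mult_l. ring.
- unfold in_disc. rewrite Cmod_R, Rabs_pos_eq; lra.
Qed.

End Rotation.

(** * Arguments and distances on the unit circle *)

Lemma e2ipi_cexp (x : R) : e2ipi x = cexp (0, 2 * PI * x).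
Proof. unfold e2ipi, cexp; simpl. rewrite exp_0, !Rmult_1_l. reflexivity. Qed.

Lemma e2ipi_plus (x y : R) : e2ipi (x + y) = (e2ipi x * e2ipi y)%C.
Proof.
rewrite !e2ipi_cexp, <- cexp_plus. f_equal. unfold Cplus; simpl. f_equal; ring.
Qed.

Lemma e2ipi_0 : e2ipi 0 = 1%C.
Proof. unfold e2ipi. rewrite Rmult_0_r, cos_0, sin_0. reflexivity. Qed.

Lemma Cmod_e2ipi (x : R) : Cmod (e2ipi x) = 1.
Proof. rewrite e2ipi_cexp, Cmod_cexp. apply exp_0. Qed.

Lemma e2ipi_pow (x : R) (n : nat) : (e2ipi x ^ n)%C = e2ipi (INR n * x).
Proof.
induction n as [|n IH].
- simpl. rewrite Rmult_0_l. symmetry. apply e2ipi_0.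
- rewrite S_INR. simpl. rewrite IH, <- e2ipi_plus. f_equal. ring.
Qed.

Lemma e2ipi_nat (n : nat) : e2ipi (INR n) = 1%C.
Proof.
rewrite <- (Rmult_1_r (INR n)), <- e2ipi_pow.
replace (e2ipi 1) with (RtoC 1) by (unfold e2ipi; rewrite Rmult_1_r, cos_2PI, sin_2PI; reflexivity).
apply Cpow_1_l.
Qed.

Lemma e2ipi_Z (m : Z) : e2ipi (IZR m) = 1%C.
Proof.
destruct (Z_le_gt_dec 0 m) as [H|H].
- rewrite <- (Z2Nat.id m H), <- INR_IZR_INZ. apply e2ipi_nat.
- assert (E := e2ipi_plus (IZR m) (IZR (- m))). rewrite <- plus_IZR, Z.add_opp_diag_r, e2ipi_0 in E.
  rewrite <- (Z2Nat.id (- m)), <- INR_IZR_INZ, e2ipi_nat in E by lia.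
  rewrite E. ring.
Qed.

(** From [sin x >= x - x^3 / 6] and [x <= 2]. *)
Lemma sin_lower_bound (x : R) : 0 <= x <= PI / 2 -> x / 3 <= sin x.
Proof.
intros Hx. assert (HP := PI_4). assert (HP0 := PI_RGT_0).
destruct (pre_sin_bound x 0) as [H _]; [lra|lra|].
unfold sin_approx, sin_term in H. simpl in H.
assert (x * x <= 4) by nra. nra.
Qed.

(** With [m] a nearest integer and [d = x - y - m], the chord has length [2 sin (pi |d|)], where
    [pi |d| <= pi / 2]. Having constant 1 here lets [g] be compared with the divisors directly. *)
Lemma e2ipi_dist (x y : R) : exists m : Z, Rabs (x - y - IZR m) <= Cmod (e2ipi x - e2ipi y).
Proof.
destruct (archimed (x - y - 1 / 2)) as [H1 H2].
exists (up (x - y - 1 / 2)). set (m := up _) in *. set (d := x - y - IZR m).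
assert (Hd : Rabs d <= 1 / 2) by (apply Rabs_le; unfold d; lra).
assert (E : (e2ipi x - e2ipi y)%C = (e2ipi y * (e2ipi d - 1))%C).
{ replace x with (y + d + IZR m) by (unfold d; ring).
  rewrite !e2ipi_plus, e2ipi_Z. ring. }
rewrite E, Cmod_mult, Cmod_e2ipi, Rmult_1_l.
assert (HP := PI2_3_2). assert (HP' := PI_RGT_0).
assert (Hs : Rabs d / 2 <= sin (PI * Rabs d)).
{ eapply Rle_trans; [|apply sin_lower_bound].
  - generalize (Rabs_pos d). nra.
  - generalize (Rabs_pos d). nra. }
assert (Hs2 : sin (PI * Rabs d) ^ 2 = sin (PI * d) ^ 2).
{ unfold Rabs. destruct (Rcase_abs d); auto.
  rewrite Ropp_mult_distr_r_reverse, sin_neg. ring. }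
assert (Hm : Cmod (e2ipi d - 1) ^ 2 = (2 * sin (PI * Rabs d)) ^ 2).
{ rewrite Cmod2_alt. unfold e2ipi; simpl Re; simpl Im.
  replace (2 * PI * d) with (2 * (PI * d)) by ring.
  rewrite cos_2a_sin, sin_2a.
  replace ((2 * sin (PI * Rabs d)) ^ 2) with (4 * sin (PI * Rabs d) ^ 2) by ring.
  rewrite Hs2. assert (S := sin2_cos2 (PI * d)). unfold Rsqr in S.
  simpl. nra. }
generalize (Rabs_pos d) (Cmod_ge_0 (e2ipi d - 1)). intros P1 P2.
apply Rsqr_incr_0_var; [|exact P2].
unfold Rsqr. replace (Cmod (e2ipi d - 1) * Cmod (e2ipi d - 1)) with (Cmod (e2ipi d - 1) ^ 2) by ring.
rewrite Hm. nra.
Qed.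

Lemma unit_e2ipi (z : C) : Cmod z = 1 -> exists x, z = e2ipi x.
Proof.
intros H. destruct (polar_form z 0) as [t [_ Ht]]; [now rewrite exp_0|].
exists (t / (2 * PI)). rewrite e2ipi_cexp, Ht. do 2 f_equal. field.
generalize PI_RGT_0; lra.
Qed.

Lemma nth_root_liminf (u : nat -> R) : (forall n, 0 <= u n) ->
  Rbar_le 1 (LimInf_seq (fun k => nth_root (u k) k)) ->
  forall rho, 0 < rho < 1 -> exists N, forall n, (N <= n)%nat -> rho ^ n <= u n.
Proof.
intros Hu HL r Hr.
assert (H : exists N, forall n, (N <= n)%nat -> r < nth_root (u n) n).
{ revert HL. unfold LimInf_seq. destruct (ex_LimInf_seq _) as [[l| |] Hl]; simpl; intros HL.
  - assert (He : 0 < 1 - r) by lra. destruct (Hl (mkposreal _ He)) as [_ [N HN]].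
    exists N. intros n Hn. specialize (HN n Hn). simpl in HN. lra.
  - exact (Hl r).
  - contradiction. }
(* [S N] excludes [n = 0], where the root has no meaning. *)
destruct H as [N HN]. exists (S N). intros n Hn. specialize (HN n ltac:(lia)).
(* Since the root of 0 is 0, the lower bound [r] forces [u n] to be nonzero. *)
unfold nth_root in HN. destruct (Req_EM_T (u n) 0) as [_|Hne]; [lra|].
assert (Hp : 0 < u n) by (generalize (Hu n); lra).
assert (Hn0 : INR n <> 0) by (apply not_0_INR; lia).
replace (u n) with (Rpower (u n) (/ INR n) ^ n).
- apply pow_incr. lra.
- rewrite <- Rpower_pow by apply exp_pos. rewrite Rpower_mult, Rinv_l, Rpower_1; auto.
Qed.

(** * Small divisors from the Diophantine condition *)

Section Diophantine.
Variables (g : Z -> R) (xi : R).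
Hypothesis g_nonneg : forall n : Z, 0 <= g n.
Hypothesis g_liminf : forall q0 : nat, (0 < q0)%nat ->
  Rbar_le 1 (LimInf_seq (fun k : nat => nth_root (g (Z.of_nat (q0 * k))) k)).
Hypothesis xi_dioph : forall (p : Z) (q : nat), (0 < q)%nat ->
  Rabs (xi - IZR p / INR q) >= g (Z.of_nat q).

Lemma g_eventually_ge (q : nat) (rho : R) : (0 < q)%nat -> 0 < rho < 1 ->
  exists N, forall n, (N <= n)%nat -> rho ^ n <= g (Z.of_nat (q * n)).
Proof. intros Hq. apply (nth_root_liminf (fun k => g (Z.of_nat (q * k)))); auto. Qed.

(** A fraction [p / q] can be rewritten with every denominator [q n], which would force
    [g (q n) = 0], while [g (q n)] is eventually positive. *)
Lemma dioph_irrational (p : Z) (q : nat) : (0 < q)%nat -> xi <> IZR p / INR q.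
Proof.
intros Hq E. destruct (g_eventually_ge q (1 / 2) Hq) as [N HN]; [lra|].
assert (H := HN (S N) ltac:(lia)).
assert (H' := xi_dioph (p * Z.of_nat (S N)) (q * S N) ltac:(lia)).
assert (0 < INR q) by (apply lt_0_INR; lia).
assert (0 < INR (S N)) by (apply lt_0_INR; lia).
replace (xi - IZR (p * Z.of_nat (S N)) / INR (q * S N)) with 0 in H'.
- rewrite Rabs_R0 in H'. assert (0 < (1 / 2) ^ S N) by (apply pow_lt; lra). lra.
- rewrite E, mult_IZR, mult_INR, <- INR_IZR_INZ. field. split; lra.
Qed.

Lemma rational_rotation_dist (p : Z) (q n : nat) : (0 < q)%nat -> (0 < n)%nat ->
  exists p' : Z, Rabs (xi - IZR p' / INR (q * n)) <= Cmod (e2ipi (IZR p / INR q) - e2ipi xi ^ n).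
Proof.
intros Hq Hn. rewrite e2ipi_pow, Cmod_minus_rev.
destruct (e2ipi_dist (INR n * xi) (IZR p / INR q)) as [m Hm].
(* [n xi - p / q - m] is [n] times the distance of [xi] to [(p + m q) / (q n)], up to sign; the
   factor [n >= 1] is then dropped. *)
exists (p + m * Z.of_nat q)%Z.
assert (0 < INR q) by (apply lt_0_INR; lia).
assert (1 <= INR n) by (apply (le_INR 1); lia).
eapply Rle_trans; [|exact Hm].
replace (INR n * xi - IZR p / INR q - IZR m) with
  (INR n * (xi - IZR (p + m * Z.of_nat q) / INR (q * n))).
- rewrite Rabs_mult, (Rabs_pos_eq (INR n)) by lra.
  generalize (Rabs_pos (xi - IZR (p + m * Z.of_nat q) / INR (q * n))). nra.
- rewrite plus_IZR, mult_IZR, mult_INR, <- INR_IZR_INZ. field. split; lra.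
Qed.

Lemma rational_rotation_bijective (p : Z) (q : nat) : (0 < q)%nat -> e2ipi (IZR p / INR q) <> 1%C ->
  bijective_on_Hol (e2ipi xi) (e2ipi (IZR p / INR q)).
Proof.
intros Hq H1. apply rotation_bijective; [apply Cmod_e2ipi| |].
(* [n = 0] is where [lam <> 1] enters; for [n > 0] equality would make [xi] rational. *)
- intros n E. destruct n as [|n]; [now apply H1|].
  destruct (rational_rotation_dist p q (S n) Hq ltac:(lia)) as [p' Hp'].
  rewrite E, Cmod_self_minus in Hp'.
  apply (dioph_irrational p' (q * S n)); [lia|].
  apply Rminus_diag_uniq. apply NNPP. intros Hn. apply Rabs_pos_lt in Hn. lra.
- intros r Hr. destruct (g_eventually_ge q r Hq Hr) as [N HN].
  exists (S N). intros n Hn.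
  destruct (rational_rotation_dist p q n Hq ltac:(lia)) as [p' Hp'].
  eapply Rle_trans; [apply HN; lia|]. eapply Rle_trans; [|exact Hp'].
  apply Rge_le, xi_dioph. nia.
Qed.

End Diophantine.

(** The divisors stay away from 0 by the distance of [lam] to the unit circle, which eventually
    exceeds [rho^n]. *)
Lemma non_unit_rotation_bijective (beta lam : C) : Cmod beta = 1 -> Cmod lam <> 1 ->
  bijective_on_Hol beta lam.
Proof.
intros Hb Hl.
assert (H : forall n, Rabs (Cmod lam - 1) <= Cmod (lam - beta ^ n)).
{ intros n. rewrite <- (Cmod_rotation_pow beta Hb n). apply Rabs_le.
  generalize (Cmod_minus_triangle lam (beta ^ n)) (Cmod_minus_triangle (beta ^ n) lam).
  rewrite (Cmod_minus_rev (beta ^ n) lam). lra. }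
assert (Hp : 0 < Rabs (Cmod lam - 1)) by (apply Rabs_pos_lt; lra).
apply rotation_bijective; auto.
- intros n E. specialize (H n). rewrite <- E, Cmod_self_minus in H. lra.
- intros r Hr. destruct (pow_lt_1_zero r ltac:(rewrite Rabs_pos_eq; lra) _ Hp) as [N HN].
  exists N. intros n Hn. specialize (HN n Hn).
  rewrite Rabs_pos_eq in HN by (apply pow_le; lra).
  eapply Rle_trans; [left; exact HN|apply H].
Qed.

(** The sign of the denominator moves to the numerator, since [xi_dioph] speaks of positive
    denominators only. *)
Lemma rational_pos_denominator (x : R) : rational x ->
  exists (p : Z) (q : nat), (0 < q)%nat /\ x = IZR p / INR q.
Proof.
intros [p [q [Hq ->]]]. exists (Z.sgn q * p)%Z, (Z.abs_nat q). split; [lia|].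
rewrite INR_IZR_INZ, Zabs2Nat.id_abs, mult_IZR.
assert (Hq' : IZR q <> 0) by (apply not_0_IZR; exact Hq).
destruct (Z.lt_trichotomy q 0) as [H|[H|H]]; [|lia|].
- rewrite Z.sgn_neg, Z.abs_neq, opp_IZR by lia. field. exact Hq'.
- rewrite Z.sgn_pos, Z.abs_eq by lia. field. exact Hq'.
Qed.

Lemma pow_n_Cpow (z : C) (n : nat) : pow_n z n = (z ^ n)%C.
Proof. induction n as [|n IH]; simpl; [reflexivity|]. now rewrite IH. Qed.

Theorem theorem4p5 (g : Z -> R) (xi : R)
  (g_nonneg : forall n : Z, 0 <= g n)
  (g_liminf : forall q0 : nat, (0 < q0)%nat ->
      Rbar_le 1 (LimInf_seq (fun k : nat => nth_root (g (Z.of_nat (q0 * k))) k)))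
  (xi_dioph : forall (p : Z) (q : nat), (0 < q)%nat ->
      Rabs (xi - IZR p / INR q) >= g (Z.of_nat q)) :
  (forall n : nat, spectrum (e2ipi xi) (pow_n (e2ipi xi) n)) /\
  (forall lam : C, spectrum (e2ipi xi) lam ->
      lam = 1%C \/ exists x : R, ~ rational x /\ lam = e2ipi x).
Proof.
split.
- intros n. rewrite pow_n_Cpow. apply rotation_eigenvalue.
- intros lam Hlam. destruct (classic (lam = 1%C)) as [|H1]; [now left|right].
  assert (Hmod : Cmod lam = 1).
  { apply NNPP. intros Hn. apply Hlam, non_unit_rotation_bijective; auto. apply Cmod_e2ipi. }
  destruct (unit_e2ipi lam Hmod) as [x Hx]. exists x. split; auto.
  intros Hr. destruct (rational_pos_denominator x Hr) as [p [q [Hq ->]]].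
  apply Hlam. rewrite Hx. apply (rational_rotation_bijective g); auto. now rewrite <- Hx.
Qed.
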